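(* Let $\mathfrak{G}$ be a presheaf of finite $p$-groups on $\mathscr{V}_f$. The following are equivalent: (1) $\mathfrak{G}$ is $p$-finite; (2) $\mathfrak{G}$ is polynomial; (3) both (a) there is $N$ such that $\Phi_N\mathfrak{G}$ is the trivial functor, and (b) each $\Phi_i\mathfrak{G}/\Phi_{i+1}\mathfrak{G}$ is a finite functor of $\mathscr{F}$; (4) $\mathfrak{G}$ has a composition series; (5) there is $d\in\mathbb{N}$ with $\gamma_{\mathfrak{G}}(t)=O(t^d)$. If moreover $\mathfrak{G}$ takes values in finite abelian $p$-groups, these conditions are also equivalent to: $\mathfrak{G}$ is a finite object (has a finite composition series) of the abelian category of functors from $\mathscr{V}_f^{\mathrm{op}}$ to finite abelian $p$-groups.
   Context: $p$ prime, $\mathbb{F}=\mathbb{F}_p$, $\mathscr{V}_f$ the category of finite-dimensional $\mathbb{F}$-vector spaces; a presheaf of finite $p$-groups is a functor $\mathscr{V}_f^{\mathrm{op}}\to$ (finite $p$-groups). $\mathscr{F}$ is the abelian category of functors $\mathscr{V}_f^{\mathrm{op}}\to$ ($\mathbb{F}$-vector spaces); a functor in $\mathscr{F}$ is finite if it has a finite composition series. For a finite $p$-group $G$, $\Phi G=[G,G]G^p$ is its Frattini subgroup; $\Phi_0G=G$, $\Phi_{n+1}G=\Phi(\Phi_nG)$. For a presheaf $\mathfrak{G}$, $\Phi_n\mathfrak{G}$ is the subpresheaf $V\mapsto\Phi_n(\mathfrak{G}(V))$, and $\Phi_n\mathfrak{G}/\Phi_{n+1}\mathfrak{G}$ takes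 values in finite-dimensional $\mathbb{F}$-vector spaces. $\mathfrak{G}$ is $p$-finite if $\bigoplus_{n\ge0}\Phi_n\mathfrak{G}/\Phi_{n+1}\mathfrak{G}$ (grading forgotten) is a finite functor of $\mathscr{F}$. Growth function: $\gamma_{\mathfrak{G}}(t)=\log_p|\mathfrak{G}(\mathbb{F}^t)|$. Polynomial (after Baues–Pirashvili): view $\mathfrak{G}$ as a covariant functor on $\mathscr{C}=\mathscr{V}_f^{\mathrm{op}}$ with monoidal structure $\oplus$ and unit $0$. Define $\mathrm{cr}_1\mathfrak{G}(V)=\ker(\mathfrak{G}(V)\to\mathfrak{G}(0))$ (map induced by $0\hookrightarrow V$), $\mathrm{cr}_2\mathfrak{G}(V,W)=\ker(\mathrm{cr}_1\mathfrak{G}(V\oplus W)\to\mathrm{cr}_1\mathfrak{G}(V)\times\mathrm{cr}_1\mathfrak{G}(W))$ (maps induced by the inclusions $V,W\hookrightarrow V\oplus W$), and recursively $\mathrm{cr}_{n+1}\mathfrak{G}(V_1,\dots,V_{n+1})=\mathrm{cr}_2(\mathrm{cr}_n\mathfrak{G}(-,V_3,\dots,V_{n+1}))(V_1,V_2)$. $\mathfrak{G}$ is polynomial of degree $\le n$ if $\mathrm{cr}_{n+1}\mathfrak{G}$ is trivial, and polynomial if it is polynomial of some degree. A composition series of $\mathfrak{G}$ means a finite chain of subpresheaves of groups $\{e\}=\mathfrak{G}_N\subset\dots\subset\mathfrak{G}_0=\mathfrak{G}$ with each $\mathfrak{G}_{i+1}$ normal in $\mathfrak{G}_i$ (sectionwise)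 and each quotient $\mathfrak{G}_i/\mathfrak{G}_{i+1}$ a simple object (non-trivial, with no proper non-trivial normal subpresheaves). *)

(* Defs.v *)
From HB Require Import structures.
From mathcomp Require Import all_boot all_order all_algebra all_fingroup all_solvable.
From mathcomp Require Import pgroup maximal.

Set Implicit Arguments.
Unset Strict Implicit.
Unset Printing Implicit Defensive.

Import GRing.Theory.

(* The category V_f of finite-dimensional F_p-vector spaces is replaced by its
   (equivalent) skeleton: objects are n : nat (standing for F_p^n), and a
   linear map F_p^m -> F_p^n is a matrix A : 'M['F_p]_(m,n) acting on row
   vectors (v |-> v *m A), so that composition "first A then B" is A *m B.
   A presheaf of finite p-groups is a contravariant functor: for each
   A : 'M_(m,n) a group homomorphism G n -> G m. *)
Record presheaf (p : nat) := Presheaf {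
  ps_obj :> nat -> finGroupType;
  ps_act : forall m n : nat, 'M['F_p]_(m, n) -> ps_obj n -> ps_obj m;
  ps_actM : forall m n (A : 'M['F_p]_(m, n)) (x y : ps_obj n),
      ps_act A (x * y)%g = (ps_act A x * ps_act A y)%g;
  ps_act1 : forall n (x : ps_obj n), ps_act (1%:M)%R x = x;
  ps_actC : forall k m n (A : 'M['F_p]_(k, m)) (B : 'M['F_p]_(m, n)) x,
      ps_act (A *m B)%R x = ps_act A (ps_act B x);
  ps_pgroup : forall n, (p.-group [set: ps_obj n])%g
}.

Arguments ps_act {p} _ {m n} _ _.

Local Open Scope group_scope.

Section Presheaves.
Variables (p : nat) (G : presheaf p).

Definition subps (H : forall n, {group G n}) : Prop :=
  forall m n (A : 'M['F_p]_(m, n)) (x : G n), x \in H n -> ps_act G A x \in H m.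

Definition eqfam (H K : forall n, {group G n}) : Prop := forall n, H n :=: K n.

Definition topfam : forall n, {group G n} := fun n => [set: G n]%G.
Definition botfam : forall n, {group G n} := fun n => 1%G.

Definition Phin (k : nat) : forall n, {group G n} :=
  fun n => iter k (fun H : {group G n} => 'Phi(H)%G) [set: G n]%G.

Definition growth (t : nat) : nat := logn p #|[set: G t]|.

Definition growth_poly_bounded : Prop :=
  exists d C T : nat, forall t, T <= t -> growth t <= C * t ^ d.

Fixpoint dimc (a : nat) (s : seq nat) : nat :=
  if s is b :: s' then dimc (a + b) s' else a.

Fixpoint extm (s : seq nat) (m n : nat) (A : 'M['F_p]_(m, n))
    : 'M['F_p]_(dimc m s, dimc n s) :=
  match s return 'M['F_p]_(dimc m s, dimc n s) with
  | [::] => A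
  | b :: s' => extm s' (block_mx A 0 0 1%:M)%R
  end.

(* cr G s a = cr_{1 + size s} G (a, b1, ..., bk) for s = [:: b1; ...; bk],
   a subgroup of G(a (+) b1 (+) ... (+) bk), defined by the recursion
   cr_{n+1} G (V1, V2, rest) = cr_2 (cr_n G (-, rest)) (V1, V2). *)
Fixpoint cr (s : seq nat) (a : nat) : {set G (dimc a s)} :=
  match s return {set G (dimc a s)} with
  | [::] => [set x : G a | ps_act G (0%R : 'M['F_p]_(0, a)) x == 1]
  | b :: s' =>
      [set x in cr s' (a + b) |
        (ps_act G (extm s' (row_mx 1%:M 0 : 'M['F_p]_(a, a + b))%R) x == 1)
        && (ps_act G (extm s' (row_mx 0 1%:M : 'M['F_p]_(b, a + b))%R) x == 1)]
  end.

Definition poly_deg_le (n : nat) : Prop :=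
  forall (s : seq nat) (a : nat), size s = n -> cr s a = 1.

Definition is_polynomial : Prop := exists n, poly_deg_le n.

(* Normal subpresheaves of the quotient L_j / L_{j+1} correspond to
   subpresheaves M with L_{j+1} <= M and M normal in L_j. *)
Definition comp_series : Prop :=
  exists (N : nat) (L : nat -> forall n, {group G n}),
  [/\ eqfam (L 0) topfam, eqfam (L N) botfam,
      forall j, j <= N -> subps (L j) &
      forall j, j < N ->
        [/\ forall n, L j.+1 n <| L j n,
            exists n, L j.+1 n != L j n &
            forall M : forall n, {group G n}, subps M ->
              (forall n, L j.+1 n \subset M n) -> (forall n, M n <| L j n) ->
              eqfam M (L j.+1) \/ eqfam M (L j)]].

(* For a section H/K (K <= H subpresheaves, H/K abelian), sub-objects of
   H/K correspond to subpresheaves M with K <= M <= H.  H/K has finite length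
   iff there is a chain H = L_0 >= ... >= L_N = K of subpresheaves with
   simple successive quotients (non-zero, no intermediate subpresheaf).
   Used both for objects of F (the values Phi_i/Phi_{i+1} are elementary
   abelian p-groups, whose subgroups are exactly the F_p-subspaces) and for
   the category of functors to finite abelian p-groups. *)
Definition finite_section (H K : forall n, {group G n}) : Prop :=
  exists (N : nat) (L : nat -> forall n, {group G n}),
  [/\ eqfam (L 0) H, eqfam (L N) K,
      forall j, j <= N -> subps (L j) &
      forall j, j < N ->
        [/\ forall n, L j.+1 n \subset L j n,
            exists n, L j.+1 n != L j n &
            forall M : forall n, {group G n}, subps M ->
              (forall n, L j.+1 n \subset M n) -> (forall n, M n \subset L j n) ->
              eqfam M (L j.+1) \/ eqfam M (L j)]].

(* An element of ((+)_k Phi_k/Phi_{k+1})(F^n) is represented by a sequence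
   x : nat -> G n with x k in Phi_k, almost all x k in Phi_{k+1}; two
   representatives are identified when they agree modulo Phi_{k+1} in each
   degree.  The group law (addition of the F_p-vector space) is the
   componentwise product.  A subfunctor is a predicate on representatives
   that is saturated, a subgroup, and stable under the structure maps. *)
Definition gel (n : nat) (x : nat -> G n) : Prop :=
  (forall k, x k \in Phin k n) /\
  (exists M, forall k, M <= k -> x k \in Phin k.+1 n).

Definition gzero (n : nat) (x : nat -> G n) : Prop :=
  gel x /\ forall k, x k \in Phin k.+1 n.

Definition gsub (S : forall n, (nat -> G n) -> Prop) : Prop :=
  [/\ forall n x, S n x -> gel x,
      forall n, S n (fun _ => 1),
      forall n x y, S n x -> S n y -> S n (fun k => x k * y k),
      forall n x, S n x -> S n (fun k => (x k)^-1) &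
      (forall n x y, S n x -> gel y ->
         (forall k, x k * (y k)^-1 \in Phin k.+1 n) -> S n y) /\
      (forall m n (A : 'M['F_p]_(m, n)) x, S n x -> S m (fun k => ps_act G A (x k)))].

Definition gincl (S T : forall n, (nat -> G n) -> Prop) : Prop :=
  forall n x, S n x -> T n x.
Definition geq (S T : forall n, (nat -> G n) -> Prop) : Prop :=
  forall n x, S n x <-> T n x.

(* p-finite: (+)_k Phi_k G / Phi_{k+1} G is a finite functor of F, i.e. has a
   finite composition series (simple quotients = non-zero, no intermediate
   subfunctor). *)
Definition p_finite : Prop :=
  exists (N : nat) (S : nat -> forall n, (nat -> G n) -> Prop),
  [/\ geq (S 0) gel, geq (S N) gzero,
      forall j, j <= N -> gsub (S j) &
      forall j, j < N ->
        [/\ gincl (S j.+1) (S j),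
            exists n x, S j n x /\ ~ S j.+1 n x &
            forall T, gsub T -> gincl (S j.+1) T -> gincl T (S j) ->
              geq T (S j.+1) \/ geq T (S j)]].

Definition cond3 : Prop :=
  (exists N, eqfam (Phin N) botfam) /\
  (forall i, finite_section (Phin i) (Phin i.+1)).

End Presheaves.

(* Main.v *)
Require Import Defs.
From HB Require Import structures.
From mathcomp Require Import all_boot all_order all_algebra all_fingroup all_solvable.
From mathcomp Require Import mxabelem boolp.

(** Each condition amounts to the vanishing of the cross effects of G on copies of the
    line F_p beyond some rank n ([line_degree_le]).

    If they vanish, the identity of G(F^t) is a group word in the operations induced by
    the coordinate projections of rank at most n. So a subpresheaf is determined by its
    value at F^n: strict chains have bounded length, which gives all the composition
    series, and an element of G(F^t) is determined by its restrictions along the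
    selections of at most n coordinates, which bounds the growth. Conversely a
    non-trivial cross effect of rank k yields at least 2^(m^k) elements of G(F^(tm)),
    for a fixed t, which forbids slow growth.

    For the composition series, one has to kill the cross effects of large rank of a
    simple section H/K with elementary abelian values. Choose m with H(F^m) <> K(F^m).
    The x in H(F^t) for which A |-> A^* x, from M_(m,t) to H(F^m)/K(F^m), is a function
    of degree < k, in the sense of iterated finite differences, form a subpresheaf. It
    is K for k = 0, and for k large it is all of H: at t = m, because the augmentation
    ideal of the group algebra over F_p of the finite p-group M_(m,m) is nilpotent,
    hence everywhere by simplicity. This applies to G itself and, for p-finiteness, to
    the presheaf of sequences in G, of which the graded functor is a subquotient. *)

Set Implicit Arguments.
Unset Strict Implicit.
Unset Printing Implicit Defensive.

Import GRing.Theory.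

(** * Iterated finite differences *)

Section FiniteDifferences.

Variables (E V : zmodType).
Local Open Scope ring_scope.
Implicit Types (gs hs : seq E) (f : E -> V).

Fixpoint fdiff gs f (a : E) : V :=
  if gs is g :: gs' then fdiff gs' f (a + g) - fdiff gs' f a else f a.

Lemma eq_fdiff gs f1 f2 : f1 =1 f2 -> fdiff gs f1 =1 fdiff gs f2.
Proof. by move=> ef; elim: gs => [|g gs IHgs] a //=; rewrite !IHgs. Qed.

Lemma fdiffD gs f1 f2 a :
  fdiff gs (fun b => f1 b + f2 b) a = fdiff gs f1 a + fdiff gs f2 a.
Proof. by elim: gs a => //= g gs IHgs a; rewrite !IHgs opprD addrACA. Qed.

Lemma fdiffN gs f a : fdiff gs (fun b => - f b) a = - fdiff gs f a.
Proof. by elim: gs a => //= g gs IHgs a; rewrite !IHgs opprD. Qed.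

Lemma fdiff0 gs a : fdiff gs (fun=> 0) a = 0.
Proof. by elim: gs a => //= g gs IHgs a; rewrite !IHgs subrr. Qed.

Lemma fdiff_translate gs f a b :
  fdiff gs (fun c => f (c + b)) a = fdiff gs f (a + b).
Proof. by elim: gs a => //= g gs IHgs a; rewrite !IHgs addrAC. Qed.

Lemma fdiff_cat gs hs f : fdiff (gs ++ hs) f =1 fdiff gs (fdiff hs f).
Proof. by elim: gs => //= g gs IHgs a; rewrite !IHgs. Qed.

Lemma fdiffC gs hs f : fdiff gs (fdiff hs f) =1 fdiff hs (fdiff gs f).
Proof.
elim: gs => [|g gs IHgs] a //=.
by rewrite !IHgs -fdiff_translate -fdiffN -fdiffD.
Qed.

Lemma perm_fdiff gs hs f : perm_eq gs hs -> fdiff gs f =1 fdiff hs f.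
Proof.
move=> ghs; pose same_fdiff s := fdiff gs f =1 fdiff s f.
apply: (@catCA_perm_ind _ same_fdiff _ _ _ ghs) => //; rewrite /same_fdiff.
move=> s1 s2 s3 e a.
by rewrite e !catA (fdiff_cat (s1 ++ s2)) (fdiff_cat (s2 ++ s1)) !fdiff_cat fdiffC.
Qed.

End FiniteDifferences.

Lemma fdiff_comp (E E' V : zmodType) (h : {additive E -> E'}) gs (f : E' -> V) a :
  fdiff gs (f \o h) a = fdiff (map h gs) f (h a).
Proof. by elim: gs a => //= g gs IHgs a; rewrite !IHgs raddfD. Qed.

Section PolynomialTranslations.

Variables (R : comNzRingType) (E : zmodType) (V : lmodType R).
Local Open Scope ring_scope.
Variables (g : E) (f : E -> V).
Implicit Types (q r : {poly R}) (a : E).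

(* R[X] acts on functions, X being the translation by g; differencing along g
   is the action of X - 1. *)
Definition poly_translate (q : {poly R}) (a : E) : V :=
  \sum_(i < size q) q`_i *: f (a + g *+ i).

Lemma poly_translate_wide n q a :
  (size q <= n)%N -> poly_translate q a = \sum_(i < n) q`_i *: f (a + g *+ i).
Proof.
move=> le_q_n.
rewrite /poly_translate (big_ord_widen n (fun i => q`_i *: f (a + g *+ i))) //.
rewrite big_mkcond; apply: eq_bigr => i _; case: ltnP => // le_q_i.
by rewrite nth_default // scale0r.
Qed.

Lemma poly_translateB q r a :
  poly_translate (q - r) a = poly_translate q a - poly_translate r a.
Proof.
have le_qr : (size (q - r)%R <= maxn (size q) (size r))%N.
  by rewrite (leq_trans (size_polyD _ _)) // size_polyN.
rewrite (poly_translate_wide a le_qr) (poly_translate_wide a (leq_maxl _ (size r))).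
rewrite (poly_translate_wide a (leq_maxr (size q) _)) -sumrB.
by apply: eq_bigr => i _; rewrite coefB scalerBl.
Qed.

Lemma poly_translateXM q a : poly_translate ('X * q) a = poly_translate q (a + g).
Proof.
have le_size : (size ('X * q)%R <= (size q).+1)%N.
  by rewrite (leq_trans (size_polyMleq _ _)) // size_polyX.
rewrite (poly_translate_wide a le_size) big_ord_recl coefXM scale0r add0r.
by apply: eq_bigr => i _; rewrite coefXM /= mulrS addrA.
Qed.

Lemma poly_translateXn n a : poly_translate 'X^n a = f (a + g *+ n).
Proof.
rewrite /poly_translate size_polyXn big_ord_recr /= coefXn eqxx scale1r.
by rewrite big1 ?add0r // => i _; rewrite coefXn ltn_eqF ?scale0r.
Qed.

Lemma fdiff_nseq n : fdiff (nseq n g) f =1 poly_translate (('X - 1) ^+ n).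
Proof.
elim: n => [|n IHn] a /=.
  by rewrite expr0 -(expr0 'X) poly_translateXn addr0.
by rewrite !IHn exprS mulrBl mul1r poly_translateB poly_translateXM.
Qed.

Lemma fdiff_nseq_pchar p a :
  p \in [pchar R] -> g *+ p = 0 -> fdiff (nseq p g) f a = 0.
Proof.
move=> pcharR gp0; have pcharRX : p \in [pchar {poly R}] by rewrite pchar_poly.
rewrite fdiff_nseq -(pFrobenius_autE pcharRX) pFrobenius_autB_comm; last exact: mulrC.
rewrite !pFrobenius_autE expr1n -(expr0 'X) poly_translateB !poly_translateXn.
by rewrite gp0 subrr.
Qed.

End PolynomialTranslations.

Lemma exists_count_mem_ge (T : finType) k (s : seq T) :
  #|T| * k < size s -> exists x, k <= count_mem x s.
Proof.
move=> lt_s; apply/existsP; apply: contraLR lt_s; rewrite negb_exists => /forallP lt_k.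
rewrite -leqNgt -[size s]sum1_size (partition_big id predT) //= -sum_nat_const.
by apply: leq_sum => x _; rewrite sum1_count ltnW // ltnNge lt_k.
Qed.

Lemma fdiff_pchar_nilpotent (R : comNzRingType) (E : finZmodType) (V : lmodType R)
    (f : E -> V) p gs a :
  p \in [pchar R]%R -> (forall g : E, g *+ p = 0)%R -> #|E| * p < size gs ->
  (fdiff gs f a = 0)%R.
Proof.
move=> pcharR pE /exists_count_mem_ge[g le_p].
rewrite -(@perm_fdiff _ _ (nseq p g ++ (nseq (count_mem g gs - p) g
          ++ [seq x <- gs | predC1 g x]))) ?fdiff_cat ?fdiff_nseq_pchar //.
rewrite catA -nseqD subnKC // -size_filter.
by rewrite -(all_pred1P _ _ (filter_all _ _)) perm_filterC.
Qed.

(** * Coordinate projections *)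

Section CoordinateProjections.

Variable R : nzRingType.
Local Open Scope ring_scope.

Definition coord_proj t (S : {set 'I_t}) : 'M[R]_t := diag_mx (\row_i (i \in S)%:R).

Lemma coord_projE t (S : {set 'I_t}) i j :
  coord_proj S i j = ((i == j) && (i \in S))%:R.
Proof. by rewrite !mxE; case: eqVneq => [->|]. Qed.

Lemma coord_projM t (S T : {set 'I_t}) :
  coord_proj S *m coord_proj T = coord_proj (S :&: T).
Proof.
by rewrite mulmx_diag; congr diag_mx; apply/rowP => i; rewrite !mxE inE -natrM mulnb.
Qed.

Lemma coord_proj_setT t : coord_proj [set: 'I_t] = 1%:M.
Proof. by rewrite -diag_const_mx; congr diag_mx; apply/rowP => i; rewrite !mxE inE. Qed.

Lemma coord_proj_set0 t : coord_proj (set0 : {set 'I_t}) = 0.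
Proof. by apply/matrixP => i j; rewrite coord_projE inE andbF mxE. Qed.

Lemma coord_projU t (S T : {set 'I_t}) :
  [disjoint S & T] -> coord_proj (S :|: T) = coord_proj S + coord_proj T.
Proof.
move=> dST; rewrite -linearD; congr diag_mx; apply/rowP => i; rewrite !mxE inE.
case: (boolP (i \in S)) => [/(disjointFr dST) ->|_]; by rewrite ?addr0 ?add0r.
Qed.

Lemma coord_proj_sum t (S : {set 'I_t}) :
  coord_proj S = \sum_(i in S) coord_proj [set i].
Proof.
have delta T : coord_proj T = \sum_(i in T) delta_mx i i.
  rewrite /coord_proj diag_mx_sum_delta [RHS]big_mkcond; apply: eq_bigr => i _.
  by rewrite mxE; case: ifP; rewrite ?scale1r ?scale0r.
by rewrite delta; apply: eq_bigr => i _; rewrite delta big_set1.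
Qed.

Definition selection_mx n t (f : {ffun 'I_n -> option 'I_t}) : 'M[R]_(n, t) :=
  \matrix_(i, j) (f i == Some j)%:R.

Lemma coord_proj_factor n t (S : {set 'I_t}) :
  (#|S| <= n)%N -> exists A f, coord_proj S = A *m @selection_mx n t f.
Proof.
move=> le_S_n; pose f := [ffun i : 'I_n => onth (enum S) i].
pose A : 'M[R]_(t, n) := \matrix_(j, i) ((j \in S) && (index j (enum S) == i))%:R.
exists A, f; apply/matrixP=> j l; rewrite coord_projE mxE.
have [jS|jS] := boolP (j \in S); last first.
  by rewrite andbF big1 // => i _; rewrite !mxE (negPf jS) mul0r.
have lt_j : (index j (enum S) < n)%N.
  by apply: leq_trans le_S_n; rewrite cardE index_mem mem_enum.
rewrite (bigD1 (Ordinal lt_j)) //= !mxE jS eqxx mul1r ffunE /=.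
rewrite onthE (nth_map j) ?index_mem ?mem_enum // nth_index ?mem_enum //.
rewrite big1 ?addr0 ?andbT // => i ij; rewrite !mxE jS /= eq_sym.
rewrite (_ : _ == _ = false) ?mul0r //.
by apply: contra_neqF ij => /eqP e; apply: val_inj.
Qed.

End CoordinateProjections.

Arguments coord_proj {R t} S.

(** * Cross effects on lines *)

Record group_presheaf (p : nat) := GroupPresheaf {
  gp_obj :> nat -> groupType;
  gp_act : forall m n : nat, 'M['F_p]_(m, n) -> gp_obj n -> gp_obj m;
  gp_actM : forall m n (A : 'M['F_p]_(m, n)) (x y : gp_obj n),
    gp_act A (x * y)%g = (gp_act A x * gp_act A y)%g;
  gp_act_id : forall n (x : gp_obj n), gp_act (1%:M)%R x = x;
  gp_act_comp : forall k m n (A : 'M['F_p]_(k, m)) (B : 'M['F_p]_(m, n)) x,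
    gp_act (A *m B)%R x = gp_act A (gp_act B x)
}.

Arguments gp_act {p} _ {m n} _ _ : simpl never.

Definition underlying p (G : presheaf p) : group_presheaf p :=
  GroupPresheaf (@ps_actM p G) (@ps_act1 p G) (@ps_actC p G).

Coercion underlying : presheaf >-> group_presheaf.

Lemma ps_actE p (G : presheaf p) m n (A : 'M['F_p]_(m, n)) :
  ps_act G A = gp_act (underlying G) A.
Proof. by []. Qed.

Section CrossEffects.

Variables (p : nat) (X : group_presheaf p).
Local Open Scope group_scope.
Local Notation act := (gp_act X).

Lemma gp_act1 m n (A : 'M['F_p]_(m, n)) : act A 1 = 1.
Proof. by apply: (mulgI (act A 1)); rewrite -gp_actM !mulg1. Qed.

Lemma gp_actV m n (A : 'M['F_p]_(m, n)) x : act A x^-1 = (act A x)^-1.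
Proof. by apply: (mulgI (act A x)); rewrite -gp_actM !mulgV gp_act1. Qed.

Definition subpresheaf (P : forall n, X n -> Prop) : Prop :=
  [/\ forall n, P n 1,
      forall n x y, P n x -> P n y -> P n (x * y),
      forall n x, P n x -> P n x^-1 &
      forall m n (A : 'M['F_p]_(m, n)) x, P n x -> P m (act A x)].

(* The cross effect at the coordinate lines indexed by S, seen inside X(F^t) through
   the projection F^t -> F^S. *)
Definition cross_effect t (S : {set 'I_t}) (z : X t) : Prop :=
  act (coord_proj S) z = z /\
  forall U : {set 'I_t}, ~~ (S \subset U) -> act (coord_proj U) z = 1.

Definition line_degree_le (n : nat) : Prop :=
  forall t (S : {set 'I_t}) z, n < #|S| -> cross_effect S z -> z = 1.

Definition line_polynomial : Prop := exists n, line_degree_le n.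

Lemma cross_effectI t (S : {set 'I_t}) z :
  act (coord_proj S) z = z ->
  (forall i, i \in S -> act (coord_proj [set~ i]) z = 1) -> cross_effect S z.
Proof.
move=> zS zi; split=> // U /subsetPn[i iS iU].
have /setIidPl <- : U \subset [set~ i] by rewrite -setCS setCK sub1set inE.
by rewrite -coord_projM gp_act_comp zi // gp_act1.
Qed.

Lemma cross_effect_act_eq1 t m (S U : {set 'I_t}) z (A : 'M['F_p]_(m, t)) :
  cross_effect S z -> (A *m coord_proj U)%R = A -> ~~ (S \subset U) -> act A z = 1.
Proof. by move=> [_ zU] <- /zU z1; rewrite gp_act_comp z1 gp_act1. Qed.

Inductive projection_word t (Q : {set 'I_t} -> Prop) : (X t -> X t) -> Prop :=
| word_proj U : Q U -> projection_word Q (act (coord_proj U))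
| word_one : projection_word Q (fun=> 1)
| word_mul f g :
    projection_word Q f -> projection_word Q g -> projection_word Q (fun x => f x * g x)
| word_inv f : projection_word Q f -> projection_word Q (fun x => (f x)^-1).

Lemma eq_projection_word t (Q : {set 'I_t} -> Prop) f g :
  f =1 g -> projection_word Q f -> projection_word Q g.
Proof. by move/funext=> ->. Qed.

Lemma projection_word_act t (Q Q' : {set 'I_t} -> Prop) V f :
  (forall U, Q U -> Q' (V :&: U)) -> projection_word Q f ->
  projection_word Q' (act (coord_proj V) \o f).
Proof.
move=> QI; elim=> {f} [U QU||f g _ IHf _ IHg|f _ IHf].
- apply: eq_projection_word (word_proj (QI U QU)) => x.
  by rewrite /= -coord_projM gp_act_comp.
- by apply: eq_projection_word (word_one _) => x; rewrite /= gp_act1.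
- by apply: eq_projection_word (word_mul IHf IHg) => x; rewrite /= gp_actM.
- by apply: eq_projection_word (word_inv IHf) => x; rewrite /= gp_actV.
Qed.

Lemma projection_word_trans t (Q Q' : {set 'I_t} -> Prop) f :
  (forall U, Q U -> projection_word Q' (act (coord_proj U))) ->
  projection_word Q f -> projection_word Q' f.
Proof.
move=> QQ'; elim=> {f} [U /QQ' //||f g _ IHf _ IHg|f _ IHf].
- exact: word_one.
- exact: word_mul.
- exact: word_inv.
Qed.

Lemma projection_word_closed t (Q : {set 'I_t} -> Prop) f (P : X t -> Prop) x :
  P 1 -> (forall y z, P y -> P z -> P (y * z)) -> (forall y, P y -> P y^-1) ->
  projection_word Q f -> (forall U, Q U -> P (act (coord_proj U) x)) -> P (f x).
Proof.
move=> P1 PM PV wf Px; elim: wf => [U /Px //||f1 f2 _ Pf1 _ Pf2|f1 _ Pf1] //.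
- exact: PM.
- exact: PV.
Qed.

Definition defect t (i : 'I_t) (x : X t) : X t := x * (act (coord_proj [set~ i]) x)^-1.

Lemma act_defect t (V : {set 'I_t}) i x :
  act (coord_proj V) (defect i x) = defect i (act (coord_proj V) x).
Proof. by rewrite /defect gp_actM gp_actV -!gp_act_comp !coord_projM setIC. Qed.

Lemma act_setC1_defect t (i : 'I_t) x : act (coord_proj [set~ i]) (defect i x) = 1.
Proof. by rewrite /defect gp_actM gp_actV -gp_act_comp coord_projM setIid mulgV. Qed.

Lemma defect1 t (i : 'I_t) : defect i 1 = 1.
Proof. by rewrite /defect gp_act1 mulgV. Qed.

Definition cross_proj t (S : {set 'I_t}) (x : X t) : X t :=
  foldr (@defect t) (act (coord_proj S) x) (enum S).

Lemma cross_proj_cross_effect t (S : {set 'I_t}) x : cross_effect S (cross_proj S x).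
Proof.
rewrite /cross_proj; apply: cross_effectI => [|i].
  elim: (enum S) => [|i s IHs] /=; last by rewrite act_defect IHs.
  by rewrite -gp_act_comp coord_projM setIid.
rewrite -mem_enum; elim: (enum S) => // j s IHs; rewrite inE => /predU1P[->|/IHs e] /=.
  exact: act_setC1_defect.
by rewrite act_defect e defect1.
Qed.

(* Expanding the defects, every factor but the first restricts to a smaller set
   of coordinates. *)
Lemma cross_proj_word t (S : {set 'I_t}) :
  exists2 f, projection_word (fun U => U \proper S) f &
    forall x, cross_proj S x = act (coord_proj S) x * f x.
Proof.
rewrite /cross_proj; have: {subset enum S <= S} by move=> i; rewrite mem_enum.
elim: (enum S) => [|i s IHs] sS /=.
  by exists (fun=> 1) => [|x]; [exact: word_one | rewrite mulg1].
have [j js|f wf fE] := IHs; first by apply: sS; rewrite inE js orbT.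
have iS : i \in S by rewrite sS ?mem_head.
exists (fun x => f x * ((act (coord_proj [set~ i]) (f x))^-1
                       * (act (coord_proj ([set~ i] :&: S)) x)^-1)).
  apply: word_mul => //; apply: word_mul; apply: word_inv.
    by apply: projection_word_act wf => U; apply: sub_proper_trans (subsetIr _ _).
  apply: word_proj; rewrite properEneq subsetIr andbT.
  by apply: contraTneq iS => <-; rewrite !inE eqxx.
by move=> x; rewrite fE /defect gp_actM -gp_act_comp coord_projM invMg !mulgA.
Qed.

Lemma line_degree_projection_word n t (S : {set 'I_t}) : line_degree_le n ->
  projection_word (fun U : {set 'I_t} => #|U| <= n) (act (coord_proj S)).
Proof.
move=> degX; have [k] := ubnP #|S|; elim: k S => // k IHk S leSk.
have [leSn|lt_n_S] := leqP #|S| n; first exact: word_proj.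
have [f wf fE] := cross_proj_word S.
apply: (@eq_projection_word _ _ (fun x => (f x)^-1)) => [x|].
  apply: (mulIg (f x)); rewrite mulVg -fE.
  by rewrite (degX _ _ _ lt_n_S (cross_proj_cross_effect S x)).
apply: word_inv; apply: projection_word_trans wf => U /proper_card ltUS.
by apply: IHk; apply: leq_trans ltUS _.
Qed.

Lemma line_degree_closed n t (P : X t -> Prop) x :
  line_degree_le n ->
  P 1 -> (forall y z, P y -> P z -> P (y * z)) -> (forall y, P y -> P y^-1) ->
  (forall U : {set 'I_t}, #|U| <= n -> P (act (coord_proj U) x)) -> P x.
Proof.
move=> degX P1 PM PV Px; rewrite -(gp_act_id x) -coord_proj_setT.
by apply: projection_word_closed Px => //; apply: line_degree_projection_word.
Qed.

Lemma line_degree_detection n t (P : forall n, X n -> Prop) (x : X t) :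
  line_degree_le n -> subpresheaf P ->
  (forall f, P n (act (selection_mx _ f : 'M_(n, t)) x)) -> P t x.
Proof.
move=> degX [P1 PM PV Pact] Px; apply: (line_degree_closed degX) => // [y z|y|U].
- exact: PM.
- exact: PV.
by move=> /(@coord_proj_factor 'F_p)[A [f ->]]; rewrite gp_act_comp; apply: Pact.
Qed.

Lemma subpresheaf1 : subpresheaf (fun n (x : X n) => x = 1).
Proof.
split=> // [n x y -> ->|n x ->|m n A x ->].
- exact: mulg1.
- exact: invg1.
- exact: gp_act1.
Qed.

Lemma line_degree_separation n t (x y : X t) :
  line_degree_le n ->
  (forall f, act (selection_mx _ f : 'M_(n, t)) x = act (selection_mx _ f) y) -> x = y.
Proof.
move=> degX exy; apply: (mulIg y^-1); rewrite mulgV.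
apply: (line_degree_detection degX subpresheaf1) => f.
by rewrite gp_actM gp_actV exy mulgV.
Qed.

End CrossEffects.

(** * Simple sections *)

Section LargeCrossEffects.

Variables (p : nat) (X : group_presheaf p).
Local Notation predicate := (forall n, X n -> Prop).
Implicit Types P Q : predicate.

Definition sub_pred P Q : Prop := forall n x, P n x -> Q n x.

Definition large_cross_sub P Q : Prop :=
  exists k, forall t (S : {set 'I_t}) z,
    k <= #|S| -> cross_effect S z -> P t z -> Q t z.

Lemma sub_large_cross_sub P Q P' Q' :
  sub_pred P' P -> sub_pred Q Q' -> large_cross_sub P Q -> large_cross_sub P' Q'.
Proof. by move=> PP QQ [k cPQ]; exists k => t S z leS cz /PP/(cPQ _ _ _ leS cz)/QQ. Qed.

Lemma large_cross_sub_chain N (L : nat -> predicate) :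
  (forall j, j < N -> large_cross_sub (L j) (L j.+1)) -> large_cross_sub (L 0) (L N).
Proof.
elim: N => [|N IHN] cL; first by exists 0.
have [j ltjN|k1 c1] := IHN; first by apply: cL; apply: leqW.
have [k2 c2] := cL N (ltnSn N); exists (maxn k1 k2) => t S z.
by rewrite geq_max => /andP[le1 le2] cz /(c1 _ _ _ le1 cz); apply: c2 cz.
Qed.

Definition normal_in P Q : Prop := forall n x y, P n x -> Q n y -> P n (x ^ y)%g.

Definition simple_section P Q : Prop :=
  forall M, subpresheaf M -> sub_pred Q M -> sub_pred M P -> normal_in M P ->
    sub_pred M Q \/ sub_pred P M.

End LargeCrossEffects.

Section DegreeFiltration.

Variables (p : nat) (X : group_presheaf p) (H : forall n, X n -> Prop).
Variables (m : nat) (V : zmodType) (rho : X m -> V).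
Local Open Scope group_scope.
Local Notation act := (gp_act X).

Hypothesis subH : subpresheaf H.
Hypothesis rhoM : forall x y, H x -> H y -> rho (x * y) = (rho x + rho y)%R.

Definition orbit_fun t (x : X t) (A : 'M['F_p]_(m, t)) : V := rho (act A x).

Lemma orbit_funM t (x y : X t) A :
  H x -> H y -> orbit_fun (x * y) A = (orbit_fun x A + orbit_fun y A)%R.
Proof.
by have [_ _ _ Hact] := subH => Hx Hy; rewrite /orbit_fun gp_actM rhoM //; apply: Hact.
Qed.

Lemma orbit_fun1 t A : orbit_fun (1 : X t) A = 0%R.
Proof.
have [H1 _ _ _] := subH.
by apply: (addrI (orbit_fun 1 A)); rewrite -orbit_funM // mulg1 addr0.
Qed.

Lemma orbit_funV t (x : X t) A : H x -> orbit_fun x^-1 A = (- orbit_fun x A)%R.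
Proof.
have [_ _ HV _] := subH => Hx; apply: (addrI (orbit_fun x A)).
by rewrite -orbit_funM ?mulgV ?orbit_fun1 ?subrr //; apply: HV.
Qed.

Definition degree_lt k t (x : X t) : Prop :=
  H x /\ forall gs a, size gs = k -> fdiff gs (orbit_fun x) a = 0%R.

Lemma degree_lt0 t (x : X t) : degree_lt 0 x <-> H x /\ forall A, rho (act A x) = 0%R.
Proof.
split=> -[Hx x0]; split=> //; first by move=> A; apply: (x0 [::]).
by move=> gs A /size0nil->; apply: x0.
Qed.

Lemma subpresheaf_degree_lt k : subpresheaf (degree_lt k).
Proof.
have [H1 HM HV Hact] := subH; split.
- by move=> t; split=> // gs a _; rewrite (eq_fdiff _ (orbit_fun1 (t := t))) fdiff0.
- move=> t x y [Hx x0] [Hy y0]; split=> [|gs a szgs]; first exact: HM.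
  by rewrite (eq_fdiff _ (fun A => orbit_funM A Hx Hy)) fdiffD x0 ?y0 ?addr0.
- move=> t x [Hx x0]; split=> [|gs a szgs]; first exact: HV.
  by rewrite (eq_fdiff _ (fun A => orbit_funV A Hx)) fdiffN x0 ?oppr0.
move=> t t' A x [Hx x0]; split=> [|gs a szgs]; first exact: Hact.
rewrite (@eq_fdiff _ _ _ _ (orbit_fun x \o mulmxr A)) => [|B].
  by rewrite fdiff_comp x0 // size_map.
by rewrite /orbit_fun /= gp_act_comp.
Qed.

Lemma degree_lt_normal k : normal_in (degree_lt k) H.
Proof.
have [_ HM HV _] := subH => t x y [Hx x0] Hy.
have [HVy Hxy] : H y^-1 /\ H (x * y) by split; [exact: HV | exact: HM].
split=> [|gs a szgs]; first by rewrite conjgE; apply: HM.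
rewrite (@eq_fdiff _ _ _ _ (orbit_fun x)) ?x0 // => A.
by rewrite conjgE !orbit_funM // orbit_funV // addrC addrK.
Qed.

End DegreeFiltration.

Lemma fdiff_cross_effect p (X : group_presheaf p) t (S T : {set 'I_t}) (z : X t) m
    (A : 'M['F_p]_(m, t)) (V : zmodType) (rho : X m -> V) s :
  rho 1%g = 0%R -> cross_effect S z -> uniq s -> {subset s <= S} ->
  {in s, forall i, i \notin T} ->
  fdiff [seq A *m coord_proj [set i] | i <- s]%R (orbit_fun rho z) (A *m coord_proj T)%R
  = orbit_fun rho z (A *m coord_proj (T :|: [set i in s]))%R.
Proof.
move=> rho1 cz; elim: s T => [|i s IHs] T /=.
  by rewrite set_nil setU0.
move=> /andP[i_s us] sS sT.
have iT : i \notin T by rewrite sT ?mem_head.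
have sS' : {subset s <= S} by move=> j js; rewrite sS // inE js orbT.
rewrite -mulmxDr -coord_projU; last by rewrite disjoint_sym disjoints1.
rewrite !IHs //.
- rewrite [in X in (_ - X)%R]/orbit_fun gp_act_comp (cz.2 (T :|: _)).
    by rewrite gp_act1 rho1 subr0 set_cons setUA.
  by apply/subsetPn; exists i; rewrite ?sS ?mem_head // !inE negb_or iT.
- by move=> j js; rewrite sT // inE js orbT.
- move=> j js; rewrite !inE negb_or sT ?inE ?js ?orbT //=.
  by apply: contraNneq i_s => <-.
Qed.

Lemma orbit_fun_cross_effect p (X : group_presheaf p) (H : forall n, X n -> Prop) m
    (V : zmodType) (rho : X m -> V) k t (S : {set 'I_t}) (z : X t) :
  rho 1%g = 0%R -> degree_lt H rho k z -> cross_effect S z -> k <= #|S| ->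
  forall A, rho (gp_act X A z) = 0%R.
Proof.
move=> rho1 [_ z0] cz leS A; pose s := take k (enum S).
have sS : {subset s <= S} by move=> i /mem_take; rewrite mem_enum.
rewrite -cz.1 -gp_act_comp.
have -> : S = (S :\: [set i in s]) :|: [set i in s].
  apply/setP => i; rewrite !inE.
  by case: (boolP (i \in s)) => [/sS ->|]; rewrite ?orbT ?orbF.
rewrite -[LHS]/(orbit_fun rho z _) -(fdiff_cross_effect _ rho1 cz) //.
- by rewrite z0 // size_map size_takel -?cardE.
- by rewrite take_uniq ?enum_uniq.
- by move=> i is_; rewrite !inE is_.
Qed.

Lemma orbit_fun_degree p (X : group_presheaf p) (H : forall n, X n -> Prop) m
    (V : lmodType 'F_p) (rho : X m -> V) t :
  prime p -> exists k, forall x : X t, H t x -> degree_lt H rho k x.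
Proof.
move=> pr_p; exists (#|{:'M['F_p]_(m, t)}| * p).+1 => x Hx; split=> // gs a szgs.
apply: (fdiff_pchar_nilpotent _ _ (pchar_Fp pr_p)) => [g|]; last by rewrite szgs.
by rewrite -scaler_nat pchar_Fp_0 // scale0r.
Qed.

Lemma simple_section_large_cross_sub p (X : group_presheaf p)
    (H K : forall n, X n -> Prop) m (V : lmodType 'F_p) (rho : X m -> V) :
  prime p -> subpresheaf H -> subpresheaf K -> sub_pred K H ->
  (forall x y, H m x -> H m y -> rho (x * y)%g = (rho x + rho y)%R) ->
  (forall x, H m x -> rho x = 0%R <-> K m x) ->
  ~ (forall x, H m x -> K m x) ->
  simple_section H K -> large_cross_sub H K.
Proof.
move=> pr_p subH subK KH rhoM rhoK neHK simpleHK.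
have [[H1 _ _ Hact] [K1 _ _ Kact]] := (subH, subK).
have rho1 : rho 1%g = 0%R by apply/rhoK.
have sub_degree k : sub_pred K (degree_lt H rho k).
  move=> t x Kx; have Hx := KH _ _ Kx; split=> // gs a _.
  rewrite (@eq_fdiff _ _ _ _ (fun=> 0%R)) ?fdiff0 // => A.
  by apply/rhoK; [exact: Hact | exact: Kact].
have dich k : sub_pred (degree_lt H rho k) K \/ sub_pred H (degree_lt H rho k).
  apply: simpleHK; last exact: degree_lt_normal.
  - exact: subpresheaf_degree_lt.
  - exact: sub_degree.
  - by move=> t x [].
have degree0K : sub_pred (degree_lt H rho 0) K.
  have [//|H0] := dich 0; case: neHK => x Hx; apply/rhoK => //.
  by have /degree_lt0[_ x0] := H0 _ _ Hx; rewrite -(gp_act_id x) x0.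
have [k degHm] := @orbit_fun_degree _ X H m V rho m pr_p.
exists k => t S z leS cz Hz; apply/degree0K/degree_lt0; split=> // A.
have [degK|Hdeg] := dich k; first by case: neHK => x /degHm/degK.
exact: orbit_fun_cross_effect rho1 (Hdeg _ _ Hz) cz leS A.
Qed.

(** * Block cross effects *)

(* [colour s c i] tells in which summand of a + b1 + ... + bk the coordinate i
   lies: b_j gets the colour k + 1 - j and c colours the coordinates of a. *)
Fixpoint colour (s : seq nat) a (c : 'I_a -> nat) : 'I_(dimc a s) -> nat :=
  match s return 'I_(dimc a s) -> nat with
  | [::] => c
  | b :: s' => colour (s := s') (a := a + b)
      (fun i => if split i is inl i then c i else (size s').+1)
  end.
Arguments colour s [a] c.

Section BlockMatrices.

Variable p : nat.
Local Open Scope ring_scope.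

Fixpoint stack t (s : seq 'I_t) m (A : 'M['F_p]_(m, t)) :
    'M['F_p]_(dimc m [seq t | _ <- s], t) :=
  match s return 'M['F_p]_(dimc m [seq t | _ <- s], t) with
  | [::] => A
  | i :: s' => stack s' (col_mx A (coord_proj [set i]))
  end.

Lemma extm_stack t (s : seq 'I_t) m n (M : 'M['F_p]_(m, n)) (A : 'M['F_p]_(n, t)) :
  extm [seq t | _ <- s] M *m stack s A = stack s (M *m A).
Proof.
elim: s m n M A => [|i s IHs] m n M A //=.
by rewrite IHs mul_block_col !mul0mx mul1mx add0r addr0.
Qed.

Lemma stack_coord_proj t (s : seq 'I_t) m (A : 'M['F_p]_(m, t)) (T : {set 'I_t}) :
  A *m coord_proj T = A -> stack s A *m coord_proj (T :|: [set i in s]) = stack s A.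
Proof.
elim: s m A T => [|i s IHs] m A T AT /=.
  by rewrite set_nil setU0.
rewrite set_cons setUA IHs // mul_col_mx coord_projM (setIidPl (subsetUr _ _)).
by rewrite -AT -mulmxA coord_projM setIUr setIid (setUidPl (subsetIl _ _)).
Qed.

Lemma sub_stack t (s : seq 'I_t) m (A : 'M['F_p]_(m, t)) :
  (A <= stack s A)%MS /\ {in s, forall i, (coord_proj [set i] <= stack s A)%MS}.
Proof.
elim: s m A => [|j s IHs] m A //=.
have [Asub ssub] := IHs _ (col_mx A (coord_proj [set j])); move: Asub.
rewrite -addsmxE addsmx_sub => /andP[Asub jsub]; split=> // i.
by rewrite inE => /predU1P[->|/ssub].
Qed.

Lemma coord_proj_sub_stack t (s : seq 'I_t) (S : {set 'I_t}) :
  (coord_proj S <= stack s (coord_proj (S :\: [set i in s])))%MS.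
Proof.
have [Asub ssub] := sub_stack s (coord_proj (S :\: [set i in s])).
rewrite coord_proj_sum summx_sub // => i iS.
have [/ssub //|is_] := boolP (i \in s).
apply: submx_trans Asub; rewrite (_ : [set i] = [set i] :&: (S :\: [set i in s])).
  by rewrite -coord_projM submxMl.
by apply/esym/setIidPl; rewrite sub1set !inE is_.
Qed.

Lemma extmM s m n k (A : 'M['F_p]_(m, n)) (B : 'M['F_p]_(n, k)) :
  extm s (A *m B) = extm s A *m extm s B.
Proof.
elim: s m n k A B => [|b s IHs] m n k A B //=.
by rewrite -IHs mulmx_block !mul0mx !mulmx0 mul1mx !addr0 add0r.
Qed.

Lemma coord_proj_block a b (S : {set 'I_(a + b)}) :
  coord_proj S = block_mx (coord_proj [set i | lshift b i \in S]) 0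
                          0 (coord_proj [set i | rshift a i \in S]) :> 'M['F_p]_(a + b).
Proof.
apply/matrixP => i j; rewrite coord_projE.
case: (split_ordP i) => i' ->; case: (split_ordP j) => j' ->.
- by rewrite block_mxEul coord_projE inE eq_lshift.
- by rewrite block_mxEur mxE eq_lrshift.
- by rewrite block_mxEdl mxE eq_rlshift.
- by rewrite block_mxEdr coord_projE inE eq_rshift.
Qed.

Lemma coord_proj_lshift a b :
  coord_proj [set i : 'I_(a + b) | i < a]%N
  = (col_mx 1%:M 0 : 'M_(a + b, a)) *m row_mx 1%:M 0 :> 'M['F_p]__.
Proof.
pose S := [set i : 'I_(a + b) | i < a]%N.
have eqT : [set i | lshift b i \in S] = setT.
  by apply/setP => i; rewrite !inE /= ltn_ord.
have eq0 : [set i | rshift a i \in S] = set0.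
  by apply/setP => i; rewrite !inE /= ltnNge leq_addr.
rewrite coord_proj_block eqT eq0 coord_proj_setT coord_proj_set0.
by rewrite mul_col_row !mul1mx !mul0mx.
Qed.

Lemma coord_proj_rshift a b :
  coord_proj [set i : 'I_(a + b) | a <= i]%N
  = (col_mx 0 1%:M : 'M_(a + b, b)) *m row_mx 0 1%:M :> 'M['F_p]__.
Proof.
pose S := [set i : 'I_(a + b) | a <= i]%N.
have eq0 : [set i | lshift b i \in S] = set0.
  by apply/setP => i; rewrite !inE /= leqNgt ltn_ord.
have eqT : [set i | rshift a i \in S] = setT.
  by apply/setP => i; rewrite !inE /= leq_addr.
rewrite coord_proj_block eqT eq0 coord_proj_setT coord_proj_set0.
by rewrite mul_col_row !mul1mx !mul0mx.
Qed.

Lemma coord_proj_colour s a (c : 'I_a -> nat) (Q : pred nat) :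
  (forall j, (0 < j <= size s)%N -> Q j) ->
  coord_proj [set i | Q (colour s c i)]
  = extm s (coord_proj [set i | Q (c i)] : 'M['F_p]_a).
Proof.
elim: s a c => [|b s IHs] a c Qs //=; rewrite IHs; last first.
  by move=> j /andP[j0 js]; apply: Qs; rewrite j0 (leqW js).
congr extm; rewrite coord_proj_block -coord_proj_setT.
congr block_mx; congr coord_proj; apply/setP => i; rewrite !inE.
  by rewrite (unsplitK (inl i)).
by rewrite (unsplitK (inr i)) Qs //= leqnn.
Qed.

End BlockMatrices.

Lemma exists_unused_colour (I : finType) (U : {set I}) (c : I -> nat) n :
  #|U| <= n -> exists2 j, j <= n & {in U, forall i, c i != j}.
Proof.
move=> leUn; pose h i : 'I_n.+1 := inord (c i).
have /subsetPn[j _ jh] : ~~ ([set: 'I_n.+1] \subset h @: U).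
  apply/negP => /subset_leq_card; rewrite cardsT card_ord leqNgt ltnS.
  by rewrite (leq_trans (leq_imset_card _ _)).
exists j => [|i iU]; first by rewrite -ltnS.
by apply: contraNneq jh => cj; apply/imsetP; exists i; rewrite // /h cj inord_val.
Qed.

Section PolynomialDegree.

Variables (p : nat) (G : presheaf p).
Local Open Scope group_scope.
Local Notation act := (gp_act G).

Lemma act_stack_in_cr t (S T : {set 'I_t}) (z : G t) (s : seq 'I_t) m
    (A : 'M['F_p]_(m, t)) i0 :
  cross_effect (X := G) S z -> i0 \in S -> i0 \notin s -> i0 \in T -> uniq s ->
  {subset s <= S} -> {in s, forall i, i \notin T} -> (A *m coord_proj T)%R = A ->
  act (stack s A) z \in cr G [seq t | _ <- s] m.
Proof.
move=> cz i0S; elim: s m A T => [|i s IHs] m A T i0s i0T us sS sT AT /=.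
  rewrite inE !ps_actE -gp_act_comp mul0mx; apply/eqP.
  apply: (cross_effect_act_eq1 (U := set0) cz); first by rewrite mul0mx.
  by apply/subsetPn; exists i0; rewrite ?inE.
move: i0s us; rewrite inE negb_or => /andP[i0i i0s] /= /andP[i_s us].
have iS : i \in S by rewrite sS ?mem_head.
rewrite inE !ps_actE -!gp_act_comp !extm_stack !mul_row_col !mul0mx !mul1mx addr0 add0r.
apply/and3P; split.
- apply: (IHs _ _ (i |: T)) => //.
  + by rewrite !inE i0T orbT.
  + by move=> j js; rewrite sS // inE js orbT.
  + move=> j js; rewrite !inE negb_or sT ?inE ?js ?orbT // andbT.
    by apply: contraNneq i_s => <-.
  + rewrite mul_col_mx coord_projM (setIidPl (subsetUl _ _)); congr col_mx.
    by rewrite -AT -mulmxA coord_projM (setIidPl (subsetUr _ _)).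
- apply/eqP/(cross_effect_act_eq1 cz (stack_coord_proj s AT)).
  by apply/subsetPn; exists i; rewrite // !inE negb_or i_s sT ?mem_head.
- apply/eqP/(cross_effect_act_eq1 (U := [set i] :|: [set j in s]) cz).
    by apply: stack_coord_proj; rewrite coord_projM setIid.
  by apply/subsetPn; exists i0; rewrite // !inE negb_or i0i.
Qed.

Lemma poly_deg_le_line_degree_le n : poly_deg_le G n -> line_degree_le G n.
Proof.
move=> degG t S z lt_n_S cz.
have [i0 i0S] : exists i0, i0 \in S.
  by apply/set0Pn; rewrite -card_gt0 (leq_trans _ lt_n_S).
pose s := take n (enum (S :\ i0)); pose T := S :\: [set i in s].
have sE i : i \in s -> i \in S :\ i0 by move/mem_take; rewrite mem_enum.
have szs : size s = n.
  by move: lt_n_S; rewrite (cardsD1 i0) i0S /s => leS; rewrite size_takel // -cardE.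
have i0s : i0 \notin s by apply/negP => /sE; rewrite !inE eqxx.
have /set1gP z1 : act (stack s (coord_proj T)) z \in [1].
  rewrite -(degG [seq t | _ <- s]) ?size_map //.
  apply: (act_stack_in_cr (T := T) cz i0S i0s).
  - by rewrite !inE i0s.
  - by rewrite take_uniq ?enum_uniq.
  - by move=> i /sE /setD1P[].
  - by move=> i is_; rewrite !inE is_.
  - by rewrite coord_projM setIid.
have /submxP[J SJ] := coord_proj_sub_stack p s S.
by rewrite -cz.1 SJ gp_act_comp z1 gp_act1.
Qed.

Lemma act_colour_neq s a (c : 'I_a -> nat) x j :
  x \in cr G s a -> 0 < j <= size s -> (forall i, ~~ (0 < c i <= size s)) ->
  act (coord_proj [set i | colour s c i != j]) x = 1.
Proof.
elim: s a c x => [|b s IHs] a c x; first by move=> _ /andP[/leq_trans h /h].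
rewrite /= inE !ps_actE => /and3P[xs /eqP xa _] jP cP.
have [jE|js] := eqVneq j (size s).+1.
  rewrite (@coord_proj_colour p s _ _ (predC1 j)) => [|l /andP[_ ls]] /=; last first.
    by rewrite jE neq_ltn ltnS ls.
  rewrite (_ : [set i | _] = [set i : 'I_(a + b) | i < a]).
    by rewrite coord_proj_lshift extmM gp_act_comp xa gp_act1.
  apply/setP => i; rewrite !inE; case: splitP => i' _; last by rewrite jE eqxx.
  by apply: contraNneq (cP i') => ->.
apply: IHs => // [|i]; first by move: jP; rewrite (leq_eqVlt j) (negPf js).
case: split => i'; last by rewrite /= ltnn.
by apply: contra (cP i') => /andP[-> /leqW].
Qed.

Lemma act_colour_neq0 s a x :
  x \in cr G s a ->
  act (coord_proj [set i | colour s (fun _ : 'I_a => 0) i != 0]) x = 1.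
Proof.
case: s x => [|b s] x /=; rewrite inE !ps_actE.
  move=> /eqP x1; rewrite (_ : [set i | _] = set0) ?coord_proj_set0; last first.
    by apply/setP => i; rewrite !inE.
  by rewrite -(mulmx0 _ (0 : 'M_(a, 0))%R) gp_act_comp x1 gp_act1.
move=> /and3P[_ _ /eqP xb].
rewrite (@coord_proj_colour p s _ _ (predC1 0)) => [|[|l]] //=.
rewrite (_ : [set i | _] = [set i : 'I_(a + b) | a <= i]).
  by rewrite coord_proj_rshift extmM gp_act_comp xb gp_act1.
by apply/setP => i; rewrite !inE leqNgt; case: splitP.
Qed.

Lemma cr1 s a : 1 \in cr G s a.
Proof.
elim: s a => [|b s IHs] a /=; rewrite inE !ps_actE !gp_act1 ?eqxx //.
by rewrite IHs.
Qed.

Lemma line_degree_le_poly_deg_le n : line_degree_le G n -> poly_deg_le G n.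
Proof.
move=> degG s a szs; apply/eqP; rewrite eqEsubset sub1set cr1 andbT.
apply/subsetP => x xcr; apply/set1gP.
have [_ mul_eq1 inv_eq1 _] := subpresheaf1 G.
apply: (line_degree_closed degG (erefl 1) (@mul_eq1 _) (@inv_eq1 _)) => U leUn.
have [j js jU] := exists_unused_colour (colour s (fun _ : 'I_a => 0)) leUn.
pose T := [set i | colour s (fun _ : 'I_a => 0) i != j].
have /setIidPl <- : U \subset T by apply/subsetP => i /jU; rewrite inE.
rewrite -coord_projM gp_act_comp (_ : act (coord_proj T) x = 1) ?gp_act1 //.
move: js @T {jU}; rewrite -szs; case: j => [|j] js; first exact: act_colour_neq0.
exact: act_colour_neq.
Qed.

Lemma is_polynomialP : is_polynomial G <-> line_polynomial G.
Proof.
split=> -[n degG]; exists n.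
  exact: poly_deg_le_line_degree_le.
exact: line_degree_le_poly_deg_le.
Qed.

End PolynomialDegree.

(** * Growth *)

Lemma leq_exp2_card_dual (I : finType) (F : {set I}) (gT hT : finGroupType)
    (w : I -> gT) (phi : I -> gT -> hT) (z : hT) :
  z != 1%g -> (forall f, {morph phi f : x y / x * y}%g) ->
  {in F &, forall f g, phi f (w g) = if g == f then z else 1%g} ->
  2 ^ #|F| <= #|gT|.
Proof.
move=> z1 phiM phi_w.
have phi1 f : phi f 1%g = 1%g by apply: (mulgI (phi f 1%g)); rewrite -phiM !mulg1.
pose prod_w (U : {set I}) := (\prod_(f in U) w f)%g.
have phi_prod f (U : {set I}) :
    f \in F -> U \subset F -> phi f (prod_w U) = if f \in U then z else 1%g.
  move=> fF /subsetP UF; rewrite /prod_w (big_morph _ (phiM f) (phi1 f)).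
  rewrite (eq_bigr (fun g => if g == f then z else 1%g)) => [|g /UF]; last exact: phi_w.
  rewrite -big_mkcondr; case: (boolP (f \in U)) => fU.
    by rewrite (big_pred1 f) // => g /=; case: eqP => [->|]; rewrite ?fU ?andbF.
  by rewrite big_pred0 // => g /=; case: eqP => [->|]; rewrite ?(negPf fU) ?andbF.
rewrite -card_powerset -(card_in_imset (f := prod_w)) ?max_card // => U W.
rewrite !inE => UF WF eUW; apply/setP => f.
have [fF|fF] := boolP (f \in F); last first.
  by apply/idP/idP => [/(subsetP UF)|/(subsetP WF)]; rewrite (negPf fF).
have := phi_prod f U fF UF; rewrite eUW phi_prod //.
case: (f \in U); case: (f \in W) => // /eqP; last by rewrite (negPf z1).
by rewrite eq_sym (negPf z1).
Qed.

Section Growth.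

Variables (p : nat) (G : presheaf p).
Local Open Scope group_scope.
Local Notation act := (gp_act G).

Lemma card_growth t : #|G t| = (p ^ growth G t)%N.
Proof. by rewrite -cardsT -(card_pgroup (ps_pgroup G t)). Qed.

Lemma line_degree_le_growth n : prime p -> line_degree_le G n -> growth_poly_bounded G.
Proof.
move=> pr_p degG; exists n, (growth G n * 2 ^ n)%N, 1%N => t t_gt0.
pose restrictions (x : G t) :=
  [ffun f : {ffun 'I_n -> option 'I_t} => act (selection_mx _ f) x : G n].
have restrictions_inj : injective restrictions.
  move=> x y /ffunP exy; apply: (line_degree_separation degG) => f.
  by have := exy f; rewrite !ffunE.
have := leq_card restrictions restrictions_inj.
rewrite card_ffun card_ffun card_option !card_ord !card_growth -expnM.
rewrite leq_exp2l ?prime_gt1 // => /leq_trans -> //.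
rewrite -mulnA -expnMn leq_mul2l; apply/orP; right.
have [->|n_gt0] := posnP n; first by rewrite !expn0.
by rewrite leq_exp2r // mul2n -addnn -addn1 leq_add2l.
Qed.

(* The i-th line of F_p^t is sent to the f(i)-th line of the i-th block of F_p^(tm). *)
Definition graph_mx t m (f : {ffun 'I_t -> 'I_m}) : 'M['F_p]_(t, t * m) :=
  (\matrix_(i, j) (j == mxvec_index i (f i))%:R)%R.

Lemma graph_mx_tr t m (f g : {ffun 'I_t -> 'I_m}) :
  (graph_mx f *m (graph_mx g)^T)%R = coord_proj [set i | f i == g i].
Proof.
apply/matrixP => i j; rewrite coord_projE mxE (bigD1 (mxvec_index i (f i))) //=.
rewrite !mxE eqxx mul1r big1 ?addr0 => [|l /negPf lf]; last by rewrite !mxE lf mul0r.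
rewrite inE; congr ((nat_of_bool _)%:R)%R; apply/eqP/andP => [|[/eqP -> /eqP ->]] //.
by move/cast_ord_inj/enum_rank_inj => [-> ->]; rewrite !eqxx.
Qed.

Lemma cross_effect_growth t (S : {set 'I_t}) (z : G t) m :
  cross_effect (X := G) S z -> z != 1 -> m.+1 ^ #|S| <= p * growth G (t * m.+1).
Proof.
move=> cz z1; pose F := [set f in pffun_on (@ord0 m) (mem S) predT].
have cardF : #|F| = (m.+1 ^ #|S|)%N by rewrite cardsE card_pffun_on card_ord.
pose w (f : {ffun 'I_t -> 'I_m.+1}) : G (t * m.+1)%N := act (graph_mx f)^T%R z.
have act_w : {in F &, forall f g, act (graph_mx f) (w g) = if g == f then z else 1}.
  move=> f g; rewrite !inE => /pffun_onP[/supportP f0 _] /pffun_onP[/supportP g0 _].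
  rewrite /w -gp_act_comp graph_mx_tr; case: eqVneq => [->|gf].
    rewrite (_ : [set _ | _] = setT) ?coord_proj_setT ?gp_act_id //.
    by apply/setP => i; rewrite !inE eqxx.
  apply: cz.2; apply: contra gf => /subsetP fg; apply/eqP/ffunP => i.
  have [/fg|iS] := boolP (i \in S); first by rewrite inE => /eqP.
  by rewrite f0 ?g0.
have := leq_exp2_card_dual z1 (fun f => ps_actM (graph_mx f)) act_w.
rewrite cardF card_growth => le2p.
rewrite -(@leq_exp2l 2) // (leq_trans le2p) // expnM.
have [->|g_gt0] := posnP (growth G (t * m.+1)); first by rewrite !expn0.
by rewrite leq_exp2r // ltnW // ltn_expl.
Qed.

Lemma growth_line_polynomial : growth_poly_bounded G -> line_polynomial G.
Proof.
move=> [d [C [T gG]]]; exists d => t S z ltdS cz; apply/eqP; apply: contraTT isT => z1.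
have t_gt0 : 0 < t.
  by rewrite -[t]card_ord; apply: leq_trans (max_card [in S]); apply: leq_trans ltdS.
pose m := (T + p * C * t ^ d)%N.
have le_T : T <= t * m.+1.
  rewrite (leq_trans (leq_addr (p * C * t ^ d) T)) // (leq_trans (leqnSn _)) //.
  by rewrite leq_pmull.
have := cross_effect_growth m cz z1.
rewrite leqNgt => /negP[]; apply: (@leq_ltn_trans (p * (C * (t * m.+1) ^ d))).
  by rewrite leq_mul2l gG ?orbT.
apply: (@leq_trans (m.+1 ^ d.+1)); last by rewrite leq_pexp2l.
by rewrite expnMn expnS !mulnA ltn_pmul2r ?expn_gt0 // ltnS leq_addl.
Qed.

Lemma growth_poly_boundedP : prime p -> growth_poly_bounded G <-> line_polynomial G.
Proof.
move=> pr_p; split=> [|[n]]; first exact: growth_line_polynomial.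
exact: line_degree_le_growth.
Qed.

End Growth.

(** * Composition series *)

Lemma exists_maximal_nat (T : Type) (P : T -> Prop) (mu : T -> nat) b x0 :
  P x0 -> (forall x, P x -> mu x <= b) ->
  exists2 x, P x & forall y, P y -> mu y <= mu x.
Proof.
move=> Px0 Pb; pose Q k := `[< exists2 x, P x & mu x = k >].
have exQ : exists k, Q k by exists (mu x0); apply/asboolP; exists x0.
have leQ k : Q k -> k <= b by move=> /asboolP[x Px <-]; apply: Pb.
have [_ /asboolP[x Px <-] maxx] := ex_maxnP exQ leQ.
by exists x => // y Py; apply/maxx/asboolP; exists y.
Qed.

Section MaximalChains.

Variables (T : Type) (valid : T -> Prop) (incl step : T -> T -> Prop).
Variables (rank : T -> nat) (bot : T).

Hypothesis incl_refl : forall x, incl x x.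
Hypothesis incl_trans : forall x y z, incl x y -> incl y z -> incl x z.
Hypothesis step_incl : forall x y, step x y -> incl x y.
Hypothesis incl_rank : forall x y, incl x y -> rank x <= rank y.
Hypothesis rank_incl : forall x y,
  valid x -> valid y -> incl x y -> rank y <= rank x -> incl y x.
Hypothesis valid_bot : valid bot.
Hypothesis step_bot : forall x, valid x -> incl bot x -> step bot x.

Lemma maximal_chain_exists top : valid top -> incl bot top ->
  exists (N : nat) (L : nat -> T),
  [/\ L 0 = top, incl bot (L N) /\ incl (L N) bot, forall j, j <= N -> valid (L j) &
      forall j, j < N ->
        [/\ step (L j.+1) (L j), ~ incl (L j) (L j.+1) &
            forall x, valid x -> incl (L j.+1) x -> step x (L j) ->
              incl x (L j.+1) \/ incl (L j) x]].
Proof.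
have [k] := ubnP (rank top); elim: k top => // k IHk top le_top valid_top bot_top.
have [top_bot|ntop_bot] := EM (incl top bot); first by exists 0, (fun=> top).
pose below x := [/\ valid x, incl bot x, step x top & ~ incl top x].
have [x [valid_x bot_x x_top top_x] max_x] :
    exists2 x, below x & forall y, below y -> rank y <= rank x.
  apply: (@exists_maximal_nat _ _ _ (rank top) bot).
    by split=> //; apply: step_bot.
  by move=> x [_ _ /step_incl/incl_rank].
have lt_rank : rank x < rank top.
  rewrite ltnNge; apply/negP => le_rank; apply: top_x.
  by apply: rank_incl => //; apply: step_incl.
have [N [L [L0 LN validL simpleL]]] := IHk x (leq_trans lt_rank le_top) valid_x bot_x.
exists N.+1, (fun j => if j is i.+1 then L i else top); split=> // [[|j]|[|j]] //.
- exact: validL.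
- rewrite L0; split=> // y valid_y x_y y_top.
  have [|ntop_y] := EM (incl top y); [by right | left].
  by apply: rank_incl => //; apply: max_x; split=> //; apply: incl_trans x_y.
- exact: simpleL.
Qed.

End MaximalChains.

Section Families.

Variables (p : nat) (G : presheaf p).
Local Open Scope group_scope.
Local Notation family := (forall n, {group G n}).
Implicit Types H K M : family.

Definition sub_family H K : Prop := forall n, H n \subset K n.

Definition mem_family H : forall n, underlying G n -> Prop := fun n x => x \in H n.

Lemma mem_family_sub H K : sub_family H K -> sub_pred (mem_family H) (mem_family K).
Proof. by move=> sHK n; apply/subsetP/sHK. Qed.

Lemma eqfam_sub H K : sub_family H K -> sub_family K H -> eqfam H K.
Proof. by move=> sHK sKH n; apply/eqP; rewrite eqEsubset sHK sKH. Qed.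

Lemma not_sub_family H K : ~ sub_family H K -> exists n, K n != H n.
Proof.
by move=> /existsNP[n nHK]; exists n; apply/eqP => eKH; apply: nHK; rewrite eKH.
Qed.

Lemma subps_subpresheaf H : subps H -> subpresheaf (mem_family H).
Proof.
move=> sH; split=> [n|n x y xH yH|n x xH|m n A x]; rewrite /mem_family.
- exact: group1.
- exact: groupM.
- by rewrite groupV.
- exact: sH.
Qed.

Lemma subpresheaf_family (P : forall n, underlying G n -> Prop) :
  subpresheaf P -> exists2 M : family, subps M & mem_family M = P.
Proof.
move=> [P1 PM _ Pact].
have memP n (x : G n) : reflect (P n x) (x \in [set x | `[< P n x >]]).
  by rewrite inE; apply: asboolP.
have grP n : group_set [set x | `[< P n x >]].
  apply/group_setP; split=> [|x y /memP Px /memP Py]; apply/memP; first exact: P1.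
  exact: PM.
exists (fun n => Group (grP n)) => [m n A x /memP Px|]; first exact/memP/Pact.
apply: functional_extensionality_dep => n; apply/funext => x; apply/propext.
by split=> /memP.
Qed.

Lemma subps_top : subps (@topfam p G).
Proof. by move=> m n A x _; rewrite inE. Qed.

Lemma subps_bot : subps (@botfam p G).
Proof. by move=> m n A x /set1gP ->; rewrite ps_actE gp_act1 group1. Qed.

Lemma line_degree_sub_family n H K :
  line_degree_le G n -> subps H -> subps K -> sub_family K H -> #|H n| <= #|K n| ->
  sub_family H K.
Proof.
move=> degG sH sK sKH leHK t; apply/subsetP => x xH.
have eqn : K n :=: H n by apply/eqP; rewrite eqEcard sKH.
apply: (line_degree_detection degG (subps_subpresheaf sK)) => f.
by rewrite /mem_family eqn; apply: sH.
Qed.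

Lemma subps_chain_exists n (R : family -> family -> Prop) H K :
  line_degree_le G n -> subps H -> subps K -> sub_family K H ->
  (forall M M', R M M' -> sub_family M M') ->
  (forall M, subps M -> sub_family K M -> R K M) ->
  exists (N : nat) (L : nat -> family),
  [/\ eqfam (L 0) H, eqfam (L N) K,
      forall j, j <= N -> subps (L j) &
      forall j, j < N ->
        [/\ R (L j.+1) (L j), exists n, L j.+1 n != L j n &
            forall M, subps M -> sub_family (L j.+1) M -> R M (L j) ->
              eqfam M (L j.+1) \/ eqfam M (L j)]].
Proof.
move=> degG sH sK sKH subR R_K.
have [M n0|M1 M2 M3 s12 s23 t|M1 M2 s12|M1 M2 s1 s2|N [L [L0 [KL LK] sL simpleL]]] :=
  @maximal_chain_exists _ (@subps p G) sub_family R (fun M => #|M n|) K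
    _ _ subR _ _ sK R_K H sH sKH.
- exact: subxx.
- exact: subset_trans (s12 t) (s23 t).
- exact: subset_leq_card.
- exact: line_degree_sub_family degG s2 s1.
exists N, L; split=> // [||j ltjN]; [by rewrite L0 | exact: eqfam_sub|].
have [RL /not_sub_family neL simpleLj] := simpleL j ltjN; split=> // M sM sLM RM.
have [sML|sLM'] := simpleLj M sM sLM RM; [left | right]; apply: eqfam_sub => //.
exact: subR.
Qed.

Lemma line_degree_finite_section n H K :
  line_degree_le G n -> subps H -> subps K -> sub_family K H -> finite_section H K.
Proof.
by move=> degG sH sK sKH; apply: (subps_chain_exists (R := sub_family) degG).
Qed.

Lemma line_degree_comp_series n : line_degree_le G n -> comp_series G.
Proof.
move=> degG; apply: (subps_chain_exists (R := fun M M' => forall t, M t <| M' t) degG).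
- exact: subps_top.
- exact: subps_bot.
- by move=> t; apply: sub1G.
- by move=> M M' nMM' t; apply: normal_sub.
- by move=> M _ _ t; apply: normal1.
Qed.

Lemma finite_section_comp_series :
  (forall n, abelian [set: G n]) ->
  finite_section (@topfam p G) (@botfam p G) -> comp_series G.
Proof.
move=> abG [N [L [L0 LN sL simpleL]]]; exists N, L; split=> // j ltjN.
have [sLj neL simpleLj] := simpleL j ltjN; split=> // [n|M sM sLM nML].
  by rewrite -sub_abelian_normal ?sLj //; apply: abelianS (subsetT _) (abG n).
by apply: simpleLj => // n; apply: normal_sub.
Qed.

End Families.

(** * The Frattini series *)

Section FrattiniQuotients.

Local Open Scope group_scope.

Lemma iter_Phi_eq1 (gT : finGroupType) (H : {group gT}) :
  exists k, iter k (fun K : {group gT} => 'Phi(K)%G) H :=: 1.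
Proof.
have [n] := ubnP #|H|; elim: n H => // n IHn H leHn.
have [H1|ntH] := eqsVneq H 1; first by exists 0.
have [|k Phik] := IHn 'Phi(H)%G; last by exists k.+1; rewrite iterSr.
exact: leq_trans (proper_card (Phi_proper ntH)) leHn.
Qed.

Lemma Phi_quotient_coords (p : nat) (gT : finGroupType) (H K : {group gT}) :
  p.-group H -> K \subset H -> 'Phi(H) \subset K ->
  exists d (rho : gT -> 'rV['F_p]_d),
    {in H &, forall x y, rho (x * y) = (rho x + rho y)%R} /\
    {in H, forall x, (rho x == 0%R) = (x \in K)}.
Proof.
move=> pH sKH sPK.
have nKH : K <| H.
  apply: sub_der1_normal => //; apply: subset_trans sPK.
  by rewrite (Phi_joing pH) joing_subl.
have abHK : p.-abelem (H / K).
  rewrite -trivg_Phi ?quotient_pgroup // -(quotient_Phi pH) ?normal_norm //.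
  by rewrite -subG1 quotient_sub1 // (subset_trans (Phi_sub _)) ?normal_norm.
have [HK1|ntHK] := eqVneq (H / K) 1.
  exists 0, (fun=> 0%R); split=> [x y _ _|x xH]; first by rewrite addr0.
  have /subsetP sHK : H \subset K by rewrite -quotient_sub1 ?normal_norm // HK1.
  by rewrite eqxx sHK.
have mem_HK x : x \in H -> coset K x \in H / K by move=> xH; rewrite mem_quotient.
have nK x : x \in H -> x \in 'N(K) by move/(subsetP (normal_norm nKH)).
exists _, (fun x => abelem_rV abHK ntHK (coset K x)); split=> [x y xH yH|x xH].
  by rewrite morphM ?nK // abelem_rV_M ?mem_HK.
rewrite -(abelem_rV_1 abHK ntHK) (inj_in_eq (@abelem_rV_inj _ _ _ abHK ntHK)).
- by apply/eqP/idP => [/coset_idr->|/coset_id] //; apply: nK.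
- exact: mem_HK.
- exact: group1.
Qed.

Lemma subset_chain (gT : finGroupType) (L : nat -> {set gT}) N i j :
  (forall k, k < N -> L k.+1 \subset L k) -> i <= j -> j <= N -> L j \subset L i.
Proof.
move=> sL /subnKC <-; elim: (j - i) => [|k IHk] leN; first by rewrite addn0.
by rewrite addnS in leN *; apply: subset_trans (sL _ leN) (IHk (ltnW leN)).
Qed.

End FrattiniQuotients.

Section FrattiniSeries.

Variables (p : nat) (G : presheaf p).
Hypothesis pr_p : prime p.
Local Open Scope group_scope.
Local Notation family := (forall n, {group G n}).
Implicit Types H K M : family.

Lemma pgroup_family H n : p.-group (H n).
Proof. exact: pgroupS (subsetT _) (ps_pgroup G n). Qed.

Definition ps_morphism m n (A : 'M['F_p]_(m, n)) : {morphism [set: G n] >-> G m} :=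
  @Morphism _ _ [set: G n] (ps_act G A) (fun x y _ _ => ps_actM A x y).

Lemma morphim_subps H m n (A : 'M['F_p]_(m, n)) :
  subps H -> ps_morphism A @* H n \subset H m.
Proof. by move=> sH; apply/subsetP => _ /morphimP[x _ xH ->]; apply: sH. Qed.

Lemma subps_Phi H : subps H -> subps (fun n => 'Phi(H n)%G).
Proof.
move=> sH m n A x xPhi.
apply: (subsetP (PhiS (pgroup_family H m) (morphim_subps A sH))).
rewrite -(morphim_Phi _ (pgroup_family H n)) ?subsetT //.
by apply/morphimP; exists x; rewrite ?in_setT.
Qed.

Lemma subps_joing H K : subps H -> subps K -> subps (fun n => (H n <*> K n)%G).
Proof.
move=> sH sK m n A x xHK.
have : ps_act G A x \in ps_morphism A @* (H n <*> K n).
  by apply/morphimP; exists x; rewrite ?in_setT.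
rewrite morphimY ?subsetT //; apply: subsetP; rewrite join_subG.
by rewrite !(subset_trans (morphim_subps A _)) ?joing_subl ?joing_subr.
Qed.

Lemma subps_Phin k : subps (Phin G k).
Proof. by elim: k => [|k IHk]; [exact: subps_top | exact: subps_Phi]. Qed.

Lemma Phin_subS k : sub_family (Phin G k.+1) (Phin G k).
Proof. by move=> n; apply: Phi_sub. Qed.

Lemma Phin_sub k l : k <= l -> sub_family (Phin G l) (Phin G k).
Proof.
move=> lekl n; apply: (subset_chain (L := fun i => Phin G i n)) lekl (leqnn l) => i _.
exact: Phin_subS.
Qed.

Lemma Phin_eq1 n : exists k, Phin G k n :=: 1.
Proof. exact: iter_Phi_eq1. Qed.

Lemma simple_family_large_cross_sub H K :
  subps H -> subps K -> sub_family K H -> (forall n, 'Phi(H n) \subset K n) ->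
  (forall M, subps M -> sub_family K M -> (forall n, M n <| H n) ->
     eqfam M K \/ eqfam M H) ->
  large_cross_sub (mem_family H) (mem_family K).
Proof.
move=> sH sK sKH sPhiK simpleHK.
have [HK|/existsNP[m nHK]] := EM (sub_family H K).
  by exists 0 => t S z _ _; apply: mem_family_sub.
have [d [rho [rhoM rhoK]]] := Phi_quotient_coords (pgroup_family H m) (sKH m) (sPhiK m).
apply: (simple_section_large_cross_sub (H := mem_family H) (rho := rho) pr_p) => //.
- exact: subps_subpresheaf.
- exact: subps_subpresheaf.
- exact: mem_family_sub.
- by move=> x xH; rewrite /mem_family -rhoK //; split=> /eqP.
- by move=> HK; apply/nHK/subsetP.
move=> P /subpresheaf_family[M sM <-] KM MH nMH.
have nM n : M n <| H n.
  apply/andP; split; first by apply/subsetP => x; apply: MH.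
  apply/subsetP => y yH; rewrite inE; apply/subsetP => _ /imsetP[x xM ->].
  exact: nMH.
have [|eM|eM] := simpleHK M sM _ nM; first by move=> n; apply/subsetP => x; apply: KM.
  by left; apply: mem_family_sub => n; rewrite eM.
by right; apply: mem_family_sub => n; rewrite eM.
Qed.

Lemma large_cross_sub_line_polynomial :
  large_cross_sub (mem_family (@topfam p G)) (mem_family (@botfam p G)) ->
  line_polynomial G.
Proof.
move=> [k ck]; exists k => t S z ltkS cz; apply/set1gP.
by apply: (ck t S) => //; [exact: ltnW | rewrite /mem_family inE].
Qed.

Lemma large_cross_sub_family_chain N (L : nat -> family) H K :
  eqfam (L 0) H -> eqfam (L N) K ->
  (forall j, j < N -> large_cross_sub (mem_family (L j)) (mem_family (L j.+1))) ->
  large_cross_sub (mem_family H) (mem_family K).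
Proof.
move=> L0 LN /(large_cross_sub_chain (L := fun j => mem_family (L j))).
by apply: sub_large_cross_sub; apply: mem_family_sub => n; rewrite ?L0 ?LN.
Qed.

Lemma comp_series_line_polynomial : comp_series G -> line_polynomial G.
Proof.
move=> [N [L [L0 LN sL simpleL]]]; apply: large_cross_sub_line_polynomial.
apply: (large_cross_sub_family_chain L0 LN) => j ltjN.
have [nL [n neL] simpleLj] := simpleL j ltjN.
have [sLj sLj1] := (sL j (ltnW ltjN), sL j.+1 ltjN).
apply: simple_family_large_cross_sub => // [k|]; first exact: normal_sub.
pose M : family := fun k => (L j.+1 k <*> 'Phi(L j k))%G.
have [k|k|eM|eM] := simpleLj M (subps_joing sLj1 (subps_Phi sLj)).
- exact: joing_subl.
- exact: normalY (nL k) (Phi_normal _).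
- by move=> k; rewrite -(eM k) joing_subr.
case/negP: neL; rewrite -val_eqE; apply/eqP => /=.
by rewrite -[LHS]genGid; apply: Phi_nongen; rewrite joingC; apply: eM.
Qed.

Lemma finite_section_large_cross_sub H K :
  (forall n, 'Phi(H n) \subset K n) -> finite_section H K ->
  large_cross_sub (mem_family H) (mem_family K).
Proof.
move=> sPhiK [N [L [L0 LN sL simpleL]]].
have sLS n j : j < N -> L j.+1 n \subset L j n by case/simpleL.
apply: (large_cross_sub_family_chain L0 LN) => j ltjN.
have [sLj _ simpleLj] := simpleL j ltjN.
apply: simple_family_large_cross_sub => // [||n|M sM sLM nML].
- exact: sL (ltnW ltjN).
- exact: sL.
- have sLH : L j n \subset H n.
    by rewrite -L0; apply: subset_chain (sLS n) _ (ltnW ltjN).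
  have sKL : K n \subset L j.+1 n by rewrite -LN; apply: subset_chain (sLS n) ltjN _.
  exact: subset_trans (PhiS (pgroup_family H n) sLH) (subset_trans (sPhiK n) sKL).
- by apply: simpleLj => // n; apply: normal_sub.
Qed.

Lemma cond3_line_polynomial : cond3 G -> line_polynomial G.
Proof.
move=> [[N PhiN] finPhi]; apply: large_cross_sub_line_polynomial.
apply: (large_cross_sub_family_chain (L := Phin G)) PhiN _ => // j _.
exact: finite_section_large_cross_sub.
Qed.

Lemma line_degree_cond3 n : line_degree_le G n -> cond3 G.
Proof.
move=> degG; split=> [|i]; last first.
  apply: (line_degree_finite_section degG); last exact: Phin_subS.
  - exact: subps_Phin.
  - exact: subps_Phin.
have [N PhiN] := Phin_eq1 n; exists N.
have sub_bot H : sub_family (@botfam p G) H by move=> t; apply: sub1G.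
apply: eqfam_sub => //; apply: (line_degree_sub_family degG) => //.
- exact: subps_Phin.
- exact: subps_bot.
- by rewrite PhiN.
Qed.

Lemma comp_seriesP : comp_series G <-> line_polynomial G.
Proof.
split=> [|[n]]; first exact: comp_series_line_polynomial.
exact: line_degree_comp_series.
Qed.

Lemma cond3P : cond3 G <-> line_polynomial G.
Proof.
by split=> [|[n]]; [exact: cond3_line_polynomial | exact: line_degree_cond3].
Qed.

Lemma abelian_finite_sectionP :
  (forall n, abelian [set: G n]) ->
  finite_section (@topfam p G) (@botfam p G) <-> line_polynomial G.
Proof.
move=> abG; split=> [/(finite_section_comp_series abG)/comp_seriesP //|[n degG]].
apply: (line_degree_finite_section degG); [exact: subps_top | exact: subps_bot |].
by move=> t; apply: sub1G.
Qed.

End FrattiniSeries.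

(** * The graded functor of the Frattini series *)

Section FrattiniProducts.

Variables (p : nat) (I : finType) (gT : I -> finGroupType) (B : forall i, {group gT i}).
Local Open Scope group_scope.
Hypothesis pB : forall i, p.-group (B i).

Lemma pgroup_setXn : p.-group (setXn B).
Proof.
rewrite /pgroup cardsXn; elim/big_ind: _ => // [a b pa pb|i _]; last exact: pB.
by rewrite pnatM pa.
Qed.

Lemma Phi_sub_setXn (A : {group {dffun forall i, gT i}}) :
  A \subset setXn B -> 'Phi(A) \subset setXn (fun i => 'Phi(B i)).
Proof.
move=> sAB; apply/subsetP => f fPhi; apply/setXnP => i.
have sAi : dffun_morphism gT i @* A \subset B i by rewrite -morphim_dffunXn morphimS.
apply: (subsetP (PhiS (pB i) sAi)).
rewrite -(morphim_Phi _ (pgroupS sAB pgroup_setXn)) ?subsetT //.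
by apply/morphimP; exists f; rewrite ?in_setT.
Qed.

End FrattiniProducts.

Section FunctionGroup.

Variables (T : Type) (gT : groupType).
Local Open Scope group_scope.
Implicit Types f g h : T -> gT.

Let fun_mulg f g : T -> gT := fun x => f x * g x.
Let fun_oneg : T -> gT := fun=> 1.
Let fun_invg f : T -> gT := fun x => (f x)^-1.

Fact fun_mulgA : associative fun_mulg.
Proof. by move=> f g h; apply/funext => x; apply: mulgA. Qed.

Fact fun_mul1g : left_id fun_oneg fun_mulg.
Proof. by move=> f; apply/funext => x; apply: mul1g. Qed.

Fact fun_mulg1 : right_id fun_oneg fun_mulg.
Proof. by move=> f; apply/funext => x; apply: mulg1. Qed.

Fact fun_mulVg : left_inverse fun_oneg fun_invg fun_mulg.
Proof. by move=> f; apply/funext => x; apply: mulVg. Qed.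

Fact fun_mulgV : right_inverse fun_oneg fun_invg fun_mulg.
Proof. by move=> f; apply/funext => x; apply: mulgV. Qed.

HB.instance Definition _ :=
  isGroup.Build (T -> gT) fun_mulgA fun_mul1g fun_mulg1 fun_mulVg fun_mulgV.

End FunctionGroup.

Section Sequences.

Variables (p : nat) (X : group_presheaf p).
Local Open Scope group_scope.

Let seq_act m n (A : 'M['F_p]_(m, n)) (x : nat -> X n) : nat -> X m :=
  fun k => gp_act X A (x k).

Fact seq_actM m n (A : 'M['F_p]_(m, n)) x y :
  seq_act A (x * y) = seq_act A x * seq_act A y.
Proof. by apply/funext => k; apply: gp_actM. Qed.

Fact seq_act_id n (x : nat -> X n) : seq_act 1%:M%R x = x.
Proof. by apply/funext => k; apply: gp_act_id. Qed.

Fact seq_act_comp k m n (A : 'M['F_p]_(k, m)) (B : 'M['F_p]_(m, n)) x :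
  seq_act (A *m B)%R x = seq_act A (seq_act B x).
Proof. by apply/funext => i; apply: gp_act_comp. Qed.

Definition sequences : group_presheaf p :=
  GroupPresheaf seq_actM seq_act_id seq_act_comp.

Lemma line_degree_sequences n : line_degree_le X n -> line_degree_le sequences n.
Proof.
move=> degX t S z lt_n_S [zS zU]; apply/funext => k; apply: degX lt_n_S _.
split=> [|U /zU]; first exact: (congr1 (@^~ k) zS).
exact: (congr1 (@^~ k)).
Qed.

End Sequences.

Definition single (gT : groupType) i (y : gT) : nat -> gT :=
  fun k => if k == i then y else 1%g.

Lemma single_cross_effect p (X : group_presheaf p) t (S : {set 'I_t}) i (z : X t) :
  cross_effect S z -> cross_effect (X := sequences X) S (single i z).
Proof.
move=> [zS zU]; split=> [|U /zU z1]; apply/funext => k; rewrite /gp_act /= /single.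
  by case: eqP; rewrite ?gp_act1.
by case: eqP; rewrite ?gp_act1.
Qed.

Section GradedFunctor.

Variables (p : nat) (G : presheaf p).
Local Open Scope group_scope.
Local Notation gpred := (forall n, (nat -> G n) -> Prop).
Implicit Types S T : gpred.

Lemma subpresheaf_gel : subpresheaf (X := sequences G) (@gel p G).
Proof.
split=> [n|n x y [xP [M xM]] [yP [M' yM]]|n x [xP [M xM]]|m n A x [xP [M xM]]].
- by split=> [k|]; [exact: group1 | exists 0 => k _; exact: group1].
- split=> [k|]; first exact: groupM.
  by exists (maxn M M') => k; rewrite geq_max => /andP[/xM xk /yM yk]; exact: groupM.
- by split=> [k|]; [rewrite groupV | exists M => k /xM; rewrite groupV].
- by split=> [k|]; [exact: subps_Phin | exists M => k /xM; exact: subps_Phin].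
Qed.

Lemma subpresheaf_gzero : subpresheaf (X := sequences G) (@gzero p G).
Proof.
have [gel1 gelM gelV gel_act] := subpresheaf_gel.
split=> [n|n x y [gx x0] [gy y0]|n x [gx x0]|m n A x [gx x0]].
- by split=> // k; exact: group1.
- by split=> [|k]; [exact: gelM | exact: groupM].
- by split=> [|k]; [exact: gelV | rewrite groupV].
- by split=> [|k]; [exact: gel_act | exact: subps_Phin (x0 k)].
Qed.

Lemma gsubP S :
  gsub S <->
  [/\ subpresheaf (X := sequences G) S, gincl S (@gel p G) & gincl (@gzero p G) S].
Proof.
split=> [[Sgel S1 SM SV [Ssat Sact]]|[[S1 SM SV Sact] Sgel S0]].
  split=> // n x [gx x0]; apply: Ssat (S1 n) gx _ => k.
  by rewrite mul1g groupV.
split=> //; split=> // n x y Sx gy xy.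
have -> : y = (x * y^-1)^-1 * x by rewrite invMg invgK mulgKV.
have [_ gelM gelV _] := subpresheaf_gel.
apply: (SM _ _ _ _ Sx); apply/SV/S0; split=> //.
by apply: gelM (Sgel _ _ Sx) _; apply: gelV.
Qed.

Lemma gsub_gel : gsub (@gel p G).
Proof. by apply/gsubP; split=> [|//|n x []//]; apply: subpresheaf_gel. Qed.

Lemma gsub_gzero : gsub (@gzero p G).
Proof. by apply/gsubP; split=> [|n x []//|//]; apply: subpresheaf_gzero. Qed.

Section Truncation.

Variables (n N : nat).
Hypothesis PhinN : Phin G N n :=: 1.
Local Notation truncated := {dffun forall i : 'I_N, G n}.

Definition extend (f : truncated) : nat -> G n :=
  fun k => if insub k is Some i then f i else 1.

Definition truncate (x : nat -> G n) : truncated := [ffun i : 'I_N => x i].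

Lemma truncateK x : gel x -> extend (truncate x) = x.
Proof.
move=> [xP _]; apply/funext => k; rewrite /extend.
case: insubP => [i _ <-|]; first by rewrite ffunE.
rewrite -leqNgt => leNk; symmetry; apply/set1gP; move: (xP k).
by move/(subsetP (Phin_sub G leNk n)); rewrite PhinN.
Qed.

Lemma extendM : {morph extend : f g / f * g}.
Proof.
move=> f g; apply/funext => k; rewrite /extend [RHS]/mulg /=.
by case: insub => [i|]; rewrite ?ffunE ?mulg1.
Qed.

Definition trunc_set S : {set truncated} := [set f | `[< S n (extend f) >]].

Lemma mem_trunc_set S f : f \in trunc_set S <-> S n (extend f).
Proof. by rewrite inE; split=> /asboolP. Qed.

Lemma trunc_setS S T : gincl S T -> trunc_set S \subset trunc_set T.
Proof. by move=> ST; apply/subsetP => f /mem_trunc_set/ST/mem_trunc_set. Qed.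

Lemma trunc_set_group_set S :
  subpresheaf (X := sequences G) S -> group_set (trunc_set S).
Proof.
move=> [S1 SM _ _]; apply/group_setP; split=> [|f g].
  apply/mem_trunc_set; rewrite (_ : extend 1 = 1) //; apply: (mulgI (extend 1)).
  by rewrite -extendM !mulg1.
move=> /mem_trunc_set Sf /mem_trunc_set Sg; apply/mem_trunc_set.
by rewrite extendM; apply: SM.
Qed.

Lemma trunc_set_gel : trunc_set (@gel p G) \subset setXn (fun i : 'I_N => Phin G i n).
Proof.
apply/subsetP => f /mem_trunc_set[fP _]; apply/setXnP => i.
by have := fP i; rewrite /extend valK.
Qed.

Lemma setXn_Phin_trunc_set :
  setXn (fun i : 'I_N => Phin G i.+1 n) \subset trunc_set (@gzero p G).
Proof.
apply/subsetP => f /setXnP fP; apply/mem_trunc_set.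
have f0 k : extend f k \in Phin G k.+1 n.
  by rewrite /extend; case: insubP => [i _ <-|_].
split=> //; split=> [k|]; first exact: (subsetP (Phin_subS G k n)).
by exists 0 => k _.
Qed.

End Truncation.

Lemma gsub_quotient_coords S S' n : gsub S -> gsub S' -> gincl S' S ->
  exists d (rho : (nat -> G n) -> 'rV['F_p]_d),
    (forall x y, S n x -> S n y -> rho (x * y) = (rho x + rho y)%R) /\
    (forall x, S n x -> rho x = 0%R <-> S' n x).
Proof.
move=> /gsubP[subS Sgel _] /gsubP[subS' S'gel S'0] S'S.
have [N PhinN] := Phin_eq1 G n.
pose H := Group (trunc_set_group_set n N subS).
pose K := Group (trunc_set_group_set n N subS').
have sKH : K \subset H by apply: trunc_setS.
have sHgel : H \subset setXn (fun i : 'I_N => Phin G i n).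
  exact: subset_trans (trunc_setS n N Sgel) (trunc_set_gel n N).
have sPhiK : 'Phi(H) \subset K.
  apply: subset_trans (trunc_setS n N S'0).
  apply: subset_trans (setXn_Phin_trunc_set n N).
  by apply: (Phi_sub_setXn (p := p)) sHgel => i; apply: pgroup_family.
have pH : p.-group H.
  by apply: pgroupS sHgel _; apply: pgroup_setXn => i; apply: pgroup_family.
have [d [rho [rhoM rhoK]]] := Phi_quotient_coords pH sKH sPhiK.
have truncH x : S n x -> truncate N x \in H.
  by move=> Sx; apply/mem_trunc_set; rewrite truncateK //; apply: Sgel.
exists d, (rho \o truncate N); split=> [x y Sx Sy|x Sx] /=.
  by rewrite -rhoM ?truncH //; congr rho; apply/ffunP => i; rewrite !ffunE.
rewrite (rwP eqP) rhoK ?truncH //.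
have -> : (truncate N x \in K) = `[< S' n x >].
  by rewrite inE truncateK //; apply: Sgel.
by split=> /asboolP.
Qed.

Lemma simple_gsub_large_cross_sub S S' :
  prime p -> gsub S -> gsub S' -> gincl S' S -> (exists n x, S n x /\ ~ S' n x) ->
  (forall T, gsub T -> gincl S' T -> gincl T S -> Defs.geq T S' \/ Defs.geq T S) ->
  large_cross_sub (X := sequences G) S S'.
Proof.
move=> pr_p gS gS' S'S [m [x0 [Sx0 nS'x0]]] simpleS.
have [d [rho [rhoM rhoK]]] := gsub_quotient_coords m gS gS' S'S.
have [[subS Sgel _] [subS' _ S'0]] := ((gsubP S).1 gS, (gsubP S').1 gS').
apply: (simple_section_large_cross_sub (X := sequences G) (rho := rho) pr_p) => //.
  by move=> SS'; apply/nS'x0/SS'.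
move=> T subT S'T TS _.
have [|eT|eT] := simpleS T _ S'T TS; [|by left=> n x /eT|by right=> n x /eT].
by apply/gsubP; split=> // n x => [/TS/Sgel|/S'0/S'T].
Qed.

Lemma gel_single n i (y : G n) : y \in Phin G i n -> gel (single i y).
Proof.
move=> yPhi; split=> [k|]; first by rewrite /single; case: eqP => [->|].
by exists i.+1 => k ltik; rewrite /single gtn_eqF.
Qed.

Lemma p_finite_line_polynomial : prime p -> p_finite G -> line_polynomial G.
Proof.
move=> pr_p [N [S [S0 SN gS simpleS]]].
have [k ck] : large_cross_sub (X := sequences G) (@gel p G) (@gzero p G).
  apply: (@sub_large_cross_sub p (sequences G) (S 0) (S N)) => [n x /S0|n x /SN|] //.
  apply: (large_cross_sub_chain (X := sequences G)) => j ltjN.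
  have [S'S neS simpleSj] := simpleS j ltjN.
  by apply: simple_gsub_large_cross_sub => //; apply: gS => //; apply: ltnW.
exists k => t U z ltkU cz.
have zPhi i : z \in Phin G i t.
  elim: i => [|i /gel_single gz]; first by rewrite inE.
  have [_ /(_ i)] := ck t U _ (ltnW ltkU) (single_cross_effect i cz) gz.
  by rewrite /single eqxx.
have [i Phii] := Phin_eq1 G t.
by apply/set1gP; have := zPhi i; rewrite Phii.
Qed.

Lemma line_degree_gsub_sub n N S T :
  line_degree_le G n -> Phin G N n :=: 1 -> gsub S -> gsub T -> gincl S T ->
  #|trunc_set n N T| <= #|trunc_set n N S| -> gincl T S.
Proof.
move=> degG PhinN /gsubP[subS _ _] /gsubP[[_ _ _ Tact] Tgel _] ST leTS t x Tx.
have eST : trunc_set n N S = trunc_set n N T by apply/eqP; rewrite eqEcard trunc_setS.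
apply: (line_degree_detection (line_degree_sequences degG) subS) => f.
have Ty := Tact _ _ (selection_mx _ f : 'M_(n, t)) _ Tx.
rewrite -(truncateK PhinN (Tgel _ _ Ty)); apply/mem_trunc_set.
by rewrite eST; apply/mem_trunc_set; rewrite truncateK //; apply: Tgel.
Qed.

Lemma line_degree_p_finite n : line_degree_le G n -> p_finite G.
Proof.
move=> degG; have [N PhinN] := Phin_eq1 G n.
have [S m x //|S1 S2 S3 s12 s23 m x /s12/s23 //|S1 S2|S1 S2 g1 g2|m x [] //|] :=
  @maximal_chain_exists _ (@gsub p G) (@gincl p G) (@gincl p G)
    (fun S => #|trunc_set n N S|) (@gzero p G)
    _ _ (fun _ _ => id) _ _ gsub_gzero (fun _ _ => id) (@gel p G) gsub_gel.
- by move=> S12; apply/subset_leq_card/trunc_setS.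
- exact: line_degree_gsub_sub.
move=> M [S [S0 [zS Sz] gS simpleS]]; exists M, S; split=> //.
- by rewrite S0.
- by move=> m x; split=> [/Sz|/zS].
move=> j ltjM; have [S'S neS simpleSj] := simpleS j ltjM; split=> //.
  have /existsNP[m /existsNP[x /not_implyP[Sx nS'x]]] := neS.
  by exists m, x.
move=> T gT S'T TS; have [TS'|ST] := simpleSj T gT S'T TS; [left | right] => m x.
  by split=> [/TS'|/S'T].
by split=> [/TS|/ST].
Qed.

Lemma p_finiteP : prime p -> p_finite G <-> line_polynomial G.
Proof.
move=> pr_p; split=> [|[n]]; first exact: p_finite_line_polynomial.
exact: line_degree_p_finite.
Qed.

End GradedFunctor.

Theorem theorem8p7 (p : nat) (hp : prime p) (G : presheaf p) :
  [/\ p_finite G <-> is_polynomial G,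
      is_polynomial G <-> cond3 G,
      cond3 G <-> comp_series G,
      comp_series G <-> growth_poly_bounded G &
      (forall n, abelian [set: G n]) ->
        (p_finite G <-> finite_section (topfam G) (botfam G))].
Proof.
have p_finG := p_finiteP G hp; have polyG := is_polynomialP G.
have cond3G := cond3P G hp; have compG := comp_seriesP G hp.
have growthG := growth_poly_boundedP G hp.
split=> [||||/(abelian_finite_sectionP hp) finG]; tauto.
Qed.
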